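(* Let $R$ be a commutative ring and let $(N,+,\circ)$ be a finite $R$-brace. Let $A=R/\mathrm{Ann}_R(N)$ (a finite ring), and consider its decomposition $A=\bigoplus_{i=1}^t A_i$ into a direct sum of finite local rings $A_i$, with $A_i$ having maximal ideal $\mathfrak m_i$ and residue field $A_i/\mathfrak m_i\cong\mathbb F_{p_i^{\lambda_i}}$, $p_i$ prime. Let $e_1,\dots,e_t$ be the corresponding orthogonal idempotents ($e_1+\dots+e_t=1$, $A_i=Ae_i$), and let $N_i=e_iN$, so that $N=\bigoplus_{i=1}^tN_i$ as a group under $+$. The following hold. (1) For each $i=1,\dots,t$, the subbrace $N_i$ has cardinality a power of $p_i$ and is a $\mathbb Z_{p_i}(\lambda_i)$-brace. (2) If $N$ has order a power of a prime $p$, then $p_i=p$ for all $i$, and $N$ is a $\mathbb Z_p(\lambda)$-brace, where $\lambda=\gcd\{\lambda_i\mid i=1,\dots,t\}$.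
   Context: A (left) brace is a set $N$ with two group operations $+$ and $\circ$, with $(N,+)$ abelian, such that $x\circ(y+z)=(x\circ y)-x+(x\circ z)$ for all $x,y,z\in N$. Its gamma function is $x\mapsto\gamma_x$, where $\gamma_x(y)=-x+x\circ y$; each $\gamma_x$ is an automorphism of $(N,+)$. Given a ring $R$, an $R$-brace is a brace $(N,+,\circ)$ such that $(N,+)$ is an $R$-module and every $\gamma_x$ ($x\in N$) is an automorphism of $R$-modules. A subbrace is a subset which is a subgroup of both $(N,+)$ and $(N,\circ)$, with the induced operations. Rings have identity and modules are unital; $N$ is a faithful $A$-module with the induced structure. For a prime $p$ and an integer $\lambda\ge1$, $\mathbb Z_p(\lambda)$ denotes the ring of integers of the unique unramified extension of $\mathbb Q_p$ of degree $\lambda$ contained in a fixed algebraic closure of $\mathbb Q_p$. Saying that a given brace ''is a $\mathbb Z_p(\lambda)$-brace'' means that its additive group carries a $\mathbb Z_p(\lambda)$-module structure making it a $\mathbb Z_p(\lambda)$-brace. *)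

(* Defs.v *)
From HB Require Import structures.
From mathcomp Require Import all_boot all_order all_algebra all_field.
From mathcomp Require Import generic_quotient ring_quotient fraction.
From mathcomp Require Import boolp classical_sets functions cardinality.

Set Implicit Arguments.
Unset Strict Implicit.
Unset Printing Implicit Defensive.

Import GRing.Theory.
Local Open Scope ring_scope.
Local Open Scope quotient_scope.

(* The ideals of ring_quotient are proper and their quotients are nontrivial
   rings. Here R / Ann(N) is the zero ring when N = 0, so ideals may contain 1
   and quotients are possibly zero rings. *)
HB.mixin Record isAbsorbing (R : comPzRingType) (I : R -> bool) := {
  absorbing_subproof : forall a u, u \in (I : {pred R}) ->
                         a * u \in (I : {pred R})
}.

#[short(type="ideal")]
HB.structure Definition Ideal (R : comPzRingType) :=
  {I of GRing.ZmodClosed R I & isAbsorbing R I}.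

Section QuotientRing.
Variables (R : comPzRingType) (I : ideal R).

Lemma ideal_absorb a u : u \in I -> a * u \in I.
Proof. exact: absorbing_subproof. Qed.

Definition quot_ring := @Quotient.quot R I.

HB.instance Definition _ := GRing.Zmodule.on quot_ring.
HB.instance Definition _ := Quotient.on quot_ring.

Lemma quot_ringP (x y : R) :
  reflect (\pi_quot_ring x = \pi_quot_ring y) (x - y \in I).
Proof. by rewrite (Quotient.idealrBE I); apply: eqP. Qed.

Definition qr_one : quot_ring := \pi_quot_ring 1.
Definition qr_mul (x y : quot_ring) : quot_ring :=
  \pi_quot_ring (repr x * repr y).

Lemma qr_mulE x y :
  qr_mul (\pi_quot_ring x) (\pi_quot_ring y) = \pi_quot_ring (x * y).
Proof.
set x' := repr (\pi_quot_ring x); set y' := repr (\pi_quot_ring y).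
have hx : x' - x \in I by apply/quot_ringP; rewrite reprK.
have hy : y' - y \in I by apply/quot_ringP; rewrite reprK.
apply/quot_ringP; rewrite -/x' -/y'.
have -> : x' * y' - x * y = x' * (y' - y) + y * (x' - x).
  by rewrite !mulrBr (mulrC y x') (mulrC y x) addrA subrK.
by rewrite rpredD // ideal_absorb.
Qed.

Lemma qr_addE x y :
  \pi_quot_ring x + \pi_quot_ring y = \pi_quot_ring (x + y).
Proof. exact/esym/(Quotient.pi_add I). Qed.

Lemma qr_mulA : associative qr_mul.
Proof.
move=> x y z; rewrite -[x]reprK -[y]reprK -[z]reprK.
move: (repr x) (repr y) (repr z) => a b c.
by rewrite (qr_mulE b c) (qr_mulE a b) !qr_mulE mulrA.
Qed.

Lemma qr_mulC : commutative qr_mul.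
Proof. by move=> x y; rewrite /qr_mul mulrC. Qed.

Lemma qr_mul1 : left_id qr_one qr_mul.
Proof. by move=> x; rewrite -[x]reprK qr_mulE mul1r. Qed.

Lemma qr_mulDl : left_distributive qr_mul +%R.
Proof.
move=> x y z; rewrite -[x]reprK -[y]reprK -[z]reprK.
move: (repr x) (repr y) (repr z) => a b c.
by rewrite qr_addE (qr_mulE a c) (qr_mulE b c) qr_mulE qr_addE mulrDl.
Qed.

HB.instance Definition _ :=
  GRing.Zmodule_isComPzRing.Build quot_ring qr_mulA qr_mulC qr_mul1 qr_mulDl.

End QuotientRing.

Definition maximal_ideal (R : comPzRingType) (I : ideal R) : Prop :=
  1 \notin I /\
  forall J : ideal R, {subset I <= J} -> 1 \notin J -> {subset J <= I}.

Definition local_with_max (R : comPzRingType) (m : ideal R) : Prop :=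
  maximal_ideal m /\ forall J : ideal R, maximal_ideal J -> J =i m.

Section PrincipalIdeal.
Variables (R : comPzRingType) (a : R).

Definition principal_ideal : {pred R} := [pred x | `[< exists y, x = y * a >]].

Lemma principal_zmod_closed : zmod_closed principal_ideal.
Proof.
split=> [|x y /asboolP[u ->] /asboolP[v ->]]; apply/asboolP.
  by exists 0; rewrite mul0r.
by exists (u - v); rewrite mulrBl.
Qed.

Lemma principal_absorbing b u :
  u \in principal_ideal -> b * u \in principal_ideal.
Proof.
by move=> /asboolP[y ->]; apply/asboolP; exists (b * y); rewrite mulrA.
Qed.

HB.instance Definition _ :=
  GRing.isZmodClosed.Build R principal_ideal principal_zmod_closed.
HB.instance Definition _ :=
  isAbsorbing.Build R principal_ideal principal_absorbing.
End PrincipalIdeal.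

Record idem_elt (A : comPzRingType) := IdemElt {
  idem : A;
  idemP : idem * idem = idem
}.

Section Corner.
Variables (A : comPzRingType) (e : idem_elt A).

(* The ring Ae, with identity e; its elements are those fixed by e. *)
Definition corner_pred : {pred A} := [pred a : A | a * idem e == a].

Lemma corner_zmod_closed : zmod_closed corner_pred.
Proof.
split=> [|x y /eqP hx /eqP hy]; apply/eqP; first by rewrite mul0r.
by rewrite mulrBl hx hy.
Qed.

HB.instance Definition _ :=
  GRing.isZmodClosed.Build A corner_pred corner_zmod_closed.

Record corner := Corner { corner_val : A; cornerP : corner_val \in corner_pred }.

HB.instance Definition _ := [isSub for corner_val].
HB.instance Definition _ := [Choice of corner by <:].
HB.instance Definition _ := [SubChoice_isSubZmodule of corner by <:].

Lemma corner_one_subproof : idem e \in corner_pred.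
Proof. by apply/eqP; rewrite idemP. Qed.

Lemma corner_mul_subproof (x y : corner) : corner_val x * corner_val y \in corner_pred.
Proof. by apply/eqP; rewrite -mulrA (eqP (cornerP y)). Qed.

Definition corner_one := Corner corner_one_subproof.
Definition corner_mul x y := Corner (corner_mul_subproof x y).

Lemma corner_mulA : associative corner_mul.
Proof. by move=> x y z; apply: val_inj; rewrite /= mulrA. Qed.

Lemma corner_mulC : commutative corner_mul.
Proof. by move=> x y; apply: val_inj; rewrite /= mulrC. Qed.

Lemma corner_mul1 : left_id corner_one corner_mul.
Proof.
by move=> x; apply: val_inj; rewrite /= mulrC; apply/eqP/(cornerP x).
Qed.

Lemma corner_mulDl : left_distributive corner_mul +%R.
Proof. by move=> x y z; apply: val_inj; rewrite /= mulrDl. Qed.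

HB.instance Definition _ :=
  GRing.Zmodule_isComPzRing.Build corner
    corner_mulA corner_mulC corner_mul1 corner_mulDl.
End Corner.

Record brace (N : zmodType) := Brace {
  circ : N -> N -> N;
  cone : N;
  cinv : N -> N;
  circA : associative circ;
  circ1n : left_id cone circ;
  circn1 : right_id cone circ;
  circVn : left_inverse cone cinv circ;
  circnV : right_inverse cone cinv circ;
  circD : forall x y z, circ x (y + z) = circ x y - x + circ x z
}.

Definition gamma (N : zmodType) (B : brace N) (x y : N) : N := - x + circ B x y.

Definition module_brace (R : pzRingType) (N : lmodType R) (B : brace N) : Prop :=
  forall x : N, linear (gamma B x) /\ bijective (gamma B x).

Record module_structure (R : pzRingType) (N : zmodType) := ModuleStructure {
  ms_scale : R -> N -> N;
  ms_scaleA : forall a b x, ms_scale a (ms_scale b x) = ms_scale (a * b) x;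
  ms_scale1 : left_id 1 ms_scale;
  ms_scaleDr : right_distributive ms_scale +%R;
  ms_scaleDl : forall x, {morph ms_scale^~ x : a b / a + b}
}.

Definition with_module (R : pzRingType) (N : zmodType)
  of module_structure R N : Type := N.

Section WithModule.
Variables (R : pzRingType) (N : zmodType) (m : module_structure R N).

HB.instance Definition _ := GRing.Zmodule.copy (with_module m) N.
HB.instance Definition _ := GRing.Zmodule_isLmodule.Build R (with_module m)
  (ms_scaleA m) (ms_scale1 m) (ms_scaleDr m) (ms_scaleDl m).
End WithModule.

Definition admits_module_brace (R : pzRingType) (N : zmodType) (B : brace N) :
    Prop :=
  exists m : module_structure R N, forall x : N,
    linear (gamma B x : with_module m -> with_module m) /\
    bijective (gamma B x).


Record subbrace (N : zmodType) (B : brace N) := Subbrace {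
  sb_pred :> {pred N};
  sb_zmod : zmod_closed sb_pred;
  sb_cone : cone B \in sb_pred;
  sb_circ : {in sb_pred &, forall x y, circ B x y \in sb_pred};
  sb_cinv : {in sb_pred, forall x, cinv B x \in sb_pred}
}.

Section InducedBrace.
Variables (N : zmodType) (B : brace N) (S : subbrace B).

HB.instance Definition _ := GRing.isZmodClosed.Build N (sb_pred S) (sb_zmod S).

Record sb_type := SbElt { sb_val : N; sb_valP : sb_val \in sb_pred S }.

HB.instance Definition _ := [isSub for sb_val].
HB.instance Definition _ := [Choice of sb_type by <:].
HB.instance Definition _ := [SubChoice_isSubZmodule of sb_type by <:].

Definition sb_type_cone := SbElt (sb_cone S).
Definition sb_type_circ (x y : sb_type) :=
  SbElt (sb_circ (sb_valP x) (sb_valP y)).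
Definition sb_type_cinv (x : sb_type) := SbElt (sb_cinv (sb_valP x)).

Definition induced_brace : brace sb_type.
Proof.
exists sb_type_circ sb_type_cone sb_type_cinv.
- by move=> x y z; apply: val_inj; rewrite /= circA.
- by move=> x; apply: val_inj; rewrite /= circ1n.
- by move=> x; apply: val_inj; rewrite /= circn1.
- by move=> x; apply: val_inj; rewrite /= circVn.
- by move=> x; apply: val_inj; rewrite /= circnV.
- by move=> x y z; apply: val_inj; rewrite /= circD.
Defined.
End InducedBrace.

Section Annihilator.
Variables (R : comPzRingType) (N : lmodType R).

Definition Ann : {pred R} := [pred a | `[< forall x : N, a *: x = 0 >]].

Lemma Ann_zmod_closed : zmod_closed Ann.
Proof.
split=> [|a b /asboolP ha /asboolP hb]; apply/asboolP=> x.
  by rewrite scale0r.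
by rewrite scalerBl ha hb subr0.
Qed.

Lemma Ann_absorbing a u : u \in Ann -> a * u \in Ann.
Proof.
by move=> /asboolP hu; apply/asboolP=> x; rewrite -scalerA hu scaler0.
Qed.

HB.instance Definition _ := GRing.isZmodClosed.Build R Ann Ann_zmod_closed.
HB.instance Definition _ := isAbsorbing.Build R Ann Ann_absorbing.

Definition quot_scale (a : quot_ring Ann) (x : N) : N := repr a *: x.

Lemma quot_scaleE (a : R) (x : N) :
  quot_scale (\pi_(quot_ring Ann) a) x = a *: x.
Proof.
apply/eqP; rewrite -subr_eq0 -scalerBl; apply/eqP.
have: repr (\pi_(quot_ring Ann) a) - a \in Ann.
  by apply/(quot_ringP Ann); rewrite reprK.
by move/asboolP.
Qed.

Definition component (a : quot_ring Ann) : {pred N} :=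
  [pred y | `[< exists x, y = quot_scale a x >]].
End Annihilator.

(* Z_p is the inverse limit of the rings Z/p^(n+1), n : nat; the exponents start
   at 1 because 'Z_(p ^ 0) is not the zero ring. The primality proof is a
   parameter because the domain structure below needs it. *)
Record padic_int (p : nat) (pr : prime p) := PadicInt {
  padic_val : forall n, 'Z_(p ^ n.+1);
  padic_compat : forall n, (padic_val n.+1 : nat)%:R = padic_val n
}.
Coercion padic_val : padic_int >-> Funclass.

Section PadicIntegers.
Variables (p : nat) (pr : prime p).

Local Notation padic_int := (padic_int pr).

HB.instance Definition _ := gen_eqMixin padic_int.
HB.instance Definition _ := gen_choiceMixin padic_int.

Lemma padic_ext (x y : padic_int) : (forall n, x n = y n) -> x = y.
Proof.
case: x y => [x hx] [y hy] /= xy.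
have e : x = y by apply: functional_extensionality_dep.
by case: y / e hy {xy} => hy; rewrite (Prop_irrelevance hx hy).
Qed.

Lemma padic_mod_gt1 n : (1 < p ^ n.+1)%N.
Proof. by rewrite -{1}(exp1n n.+1) ltn_exp2r // prime_gt1. Qed.

Definition padic_red n (x : 'Z_(p ^ n.+2)) : 'Z_(p ^ n.+1) := (x : nat)%:R.

Lemma padic_redE n k : padic_red (k%:R : 'Z_(p ^ n.+2)) = k%:R.
Proof.
rewrite /padic_red val_Zp_nat ?padic_mod_gt1 //; apply: val_inj.
rewrite /= !val_Zp_nat ?padic_mod_gt1 // modn_dvdm //.
by rewrite (expnS _ n.+1) dvdn_mull.
Qed.

Lemma padic_redD n : {morph @padic_red n : x y / x + y}.
Proof.
by move=> x y; rewrite -[x]natr_Zp -[y]natr_Zp -natrD !padic_redE natrD.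
Qed.

Lemma padic_redM n : {morph @padic_red n : x y / x * y}.
Proof.
by move=> x y; rewrite -[x]natr_Zp -[y]natr_Zp -natrM !padic_redE natrM.
Qed.

Lemma padic_redN n : {morph @padic_red n : x / - x}.
Proof.
move=> x; apply: (addIr (padic_red x)).
by rewrite -padic_redD !addNr (padic_redE n 0).
Qed.

Lemma padic_zero_subproof n :
  padic_red (0 : 'Z_(p ^ n.+2)) = 0 :> 'Z_(p ^ n.+1).
Proof. exact: (padic_redE n 0). Qed.
Lemma padic_one_subproof n :
  padic_red (1 : 'Z_(p ^ n.+2)) = 1 :> 'Z_(p ^ n.+1).
Proof. exact: (padic_redE n 1). Qed.
Lemma padic_opp_subproof (x : padic_int) n :
  padic_red (- x n.+1) = - x n.
Proof. by rewrite padic_redN; congr (- _); apply: padic_compat. Qed.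
Lemma padic_add_subproof (x y : padic_int) n :
  padic_red (x n.+1 + y n.+1) = x n + y n.
Proof. by rewrite padic_redD; congr (_ + _); apply: padic_compat. Qed.
Lemma padic_mul_subproof (x y : padic_int) n :
  padic_red (x n.+1 * y n.+1) = x n * y n.
Proof. by rewrite padic_redM; congr (_ * _); apply: padic_compat. Qed.

Definition padic_zero := @PadicInt p pr (fun n => 0) padic_zero_subproof.
Definition padic_one := @PadicInt p pr (fun n => 1) padic_one_subproof.
Definition padic_opp (x : padic_int) := @PadicInt p pr (fun n => - x n) (padic_opp_subproof x).
Definition padic_add (x y : padic_int) :=
  @PadicInt p pr (fun n => x n + y n) (padic_add_subproof x y).
Definition padic_mul (x y : padic_int) :=
  @PadicInt p pr (fun n => x n * y n) (padic_mul_subproof x y).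

Lemma padic_addA : associative padic_add.
Proof. by move=> x y z; apply: padic_ext => n /=; rewrite addrA. Qed.
Lemma padic_addC : commutative padic_add.
Proof. by move=> x y; apply: padic_ext => n /=; rewrite addrC. Qed.
Lemma padic_add0 : left_id padic_zero padic_add.
Proof. by move=> x; apply: padic_ext => n /=; rewrite add0r. Qed.
Lemma padic_addN : left_inverse padic_zero padic_opp padic_add.
Proof. by move=> x; apply: padic_ext => n /=; rewrite addNr. Qed.

HB.instance Definition _ :=
  GRing.isZmodule.Build padic_int padic_addA padic_addC padic_add0 padic_addN.

Lemma padic_mulA : associative padic_mul.
Proof. by move=> x y z; apply: padic_ext => n /=; rewrite mulrA. Qed.
Lemma padic_mulC : commutative padic_mul.
Proof. by move=> x y; apply: padic_ext => n /=; rewrite mulrC. Qed.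
Lemma padic_mul1 : left_id padic_one padic_mul.
Proof. by move=> x; apply: padic_ext => n /=; rewrite mul1r. Qed.
Lemma padic_mulDl : left_distributive padic_mul +%R.
Proof. by move=> x y z; apply: padic_ext => n /=; rewrite mulrDl. Qed.
Lemma padic_one_neq0 : padic_one != 0.
Proof.
apply/eqP=> /(congr1 (fun x : padic_int => x 0%N)) /= /eqP.
by rewrite oner_eq0.
Qed.

HB.instance Definition _ := GRing.Zmodule_isComNzRing.Build padic_int
  padic_mulA padic_mulC padic_mul1 padic_mulDl padic_one_neq0.

Definition padic_unit : {pred padic_int} :=
  [pred x | `[< exists y : padic_int, y * x = 1 >]].
Definition padic_inv (x : padic_int) : padic_int :=
  if pselect (exists y : padic_int, y * x = 1) is left h then projT1 (cid h)
  else x.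

Lemma padic_mulVx : {in padic_unit, left_inverse 1 padic_inv *%R}.
Proof.
move=> x /asboolP hx; rewrite /padic_inv; case: pselect => // h.
exact: projT2 (cid h).
Qed.
Lemma padic_unitPl (x y : padic_int) : y * x = 1 -> padic_unit x.
Proof. by move=> yx; apply/asboolP; exists y. Qed.
Lemma padic_invr_out : {in [predC padic_unit], padic_inv =1 id}.
Proof.
move=> x /negP hx; rewrite /padic_inv; case: pselect => // h.
by case: hx; apply/asboolP.
Qed.

HB.instance Definition _ := GRing.ComNzRing_hasMulInverse.Build padic_int
  padic_mulVx padic_unitPl padic_invr_out.

Lemma padic_val_mod (x : padic_int) n m :
  (n <= m)%N -> (x m : nat)%:R = x n :> 'Z_(p ^ n.+1).
Proof.
elim: m => [|m IHm]; first by rewrite leqn0 => /eqP->; rewrite natr_Zp.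
rewrite leq_eqVlt ltnS => /predU1P[->|lenm]; first by rewrite natr_Zp.
rewrite -(IHm lenm); rewrite -(padic_compat x m).
rewrite val_Zp_nat ?padic_mod_gt1 //; apply: val_inj.
rewrite /= !val_Zp_nat ?padic_mod_gt1 // modn_dvdm //.
by rewrite dvdn_exp2l.
Qed.

Lemma padic_idomain (x y : padic_int) : x * y = 0 -> (x == 0) || (y == 0).
Proof.
move=> xy0; apply/norP => -[/eqP x0 /eqP y0].
have ex0 (z : padic_int) : z <> 0 -> exists n, padic_val z n != 0.
  move=> z0; apply/not_existsP => hz; apply: z0; apply: padic_ext => n.
  by apply/eqP/negPn/negP/hz.
have [n xn0] := ex0 x x0; have [m ym0] := ex0 y y0.
pose k := (n + m).+1.
have nz (z : padic_int) l : (l <= k)%N -> padic_val z l != 0 -> ~~ (p ^ l.+1 %| z k)%N.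
  move=> lk; apply: contraNN => /eqP h.
  rewrite -(padic_val_mod z lk); apply/eqP/val_inj.
  by rewrite /= val_Zp_nat ?padic_mod_gt1 // h.
have {xn0} hx := nz x n (leqW (leq_addr _ _)) xn0.
have {ym0} hy := nz y m (leqW (leq_addl _ _)) ym0.
have : (p ^ k.+1 %| x k * y k)%N.
  have: (x * y) k = 0 by rewrite xy0.
  move=> /(congr1 val) /=; move: (x k : nat) (y k : nat) => a b.
  by rewrite Zp_cast ?padic_mod_gt1 // => /eqP.
have pos z l : ~~ (p ^ l.+1 %| z)%N -> (0 < z)%N.
  by case: z => //; rewrite dvdn0.
have [x_gt0 y_gt0] := (pos _ _ hx, pos _ _ hy).
rewrite pfactor_dvdn ?muln_gt0 ?x_gt0 // lognM //.
rewrite !pfactor_dvdn // -!leqNgt in hx hy.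
by move=> /leq_trans/(_ (leq_add hx hy)); rewrite /k ltnNge leqnSn.
Qed.

HB.instance Definition _ :=
  GRing.ComUnitRing_isIntegral.Build padic_int padic_idomain.

Definition padic_field : fieldType := {fraction padic_int}.

End PadicIntegers.

Section RingOfIntegers.
Variables (p : nat) (pr : prime p) (L : fieldExtType (padic_field pr)).

Definition padic_emb (z : padic_int pr) : L := (tofrac z : padic_field pr)%:A.

HB.instance Definition _ := GRing.RMorphism.copy padic_emb
  (in_alg L \o @tofrac (padic_int pr)).

Definition integral_pred : {pred L} := [pred x | `[< integralOver padic_emb x >]].

Lemma integral_subring_closed : subring_closed integral_pred.
Proof.
split=> [|x y /asboolP hx /asboolP hy|x y /asboolP hx /asboolP hy].
- by apply/asboolP; apply: integral1.
- by apply/asboolP; apply: integral_sub.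
- by apply/asboolP; apply: integral_mul.
Qed.

HB.instance Definition _ :=
  GRing.isSubringClosed.Build L integral_pred integral_subring_closed.

Record ring_of_integers := RingOfIntegers {
  roi_val : L; roiP : roi_val \in integral_pred }.

HB.instance Definition _ := [isSub for roi_val].
HB.instance Definition _ := [Choice of ring_of_integers by <:].
HB.instance Definition _ := [SubChoice_isSubComNzRing of ring_of_integers by <:].

(* Ramification index 1: p generates the maximal ideal of the ring of integers.
   Separability of the residue extension is automatic, as F_p is perfect. *)
Definition unramified : Prop :=
  local_with_max (principal_ideal (p%:R : ring_of_integers)).
End RingOfIntegers.

Record algebraic_closure (F : fieldType) := AlgebraicClosure {
  acl_field : closedFieldType;
  acl_emb : {rmorphism F -> acl_field};
  acl_algebraic : forall x, algebraicOver acl_emb x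
}.

(* The subextensions of the algebraic closure Qbar which are unramified of degree
   lam over Q_p, given up to isomorphism with their embedding in Qbar; there is
   exactly one such subextension when lam > 0. *)
Record unramified_ext (p : nat) (pr : prime p)
    (Qbar : algebraic_closure (padic_field pr)) (lam : nat) := UnramifiedExt {
  ue_field : fieldExtType (padic_field pr);
  ue_emb : {rmorphism ue_field -> acl_field Qbar};
  ue_embE : forall a : padic_field pr, ue_emb a%:A = acl_emb Qbar a;
  ue_dim : \dim {: ue_field} = lam;
  ue_unramified : unramified ue_field
}.

Definition unramified_integers (p : nat) (pr : prime p)
    (Qbar : algebraic_closure (padic_field pr)) (lam : nat)
    (K : unramified_ext Qbar lam) : comNzRingType :=
  ring_of_integers (ue_field K).

Definition is_Zp_brace (p : nat) (pr : prime p)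
    (Qbar : algebraic_closure (padic_field pr)) (lam : nat)
    (N : zmodType) (B : brace N) : Prop :=
  exists K : unramified_ext Qbar lam,
    admits_module_brace (unramified_integers K) B.

(* Main.v *)
Require Import Defs.
From HB Require Import structures.
From mathcomp Require Import all_boot all_order all_algebra.
From mathcomp Require Import all_fingroup all_solvable all_field.
From mathcomp Require Import generic_quotient fraction zify ring.
From mathcomp Require Import boolp classical_sets functions cardinality.

Set Implicit Arguments.
Unset Strict Implicit.
Unset Printing Implicit Defensive.

Import GRing.Theory.
Local Open Scope ring_scope.
Local Open Scope quotient_scope.

(** A brace that is a module brace over a ring R' is one over every ring S with a
    morphism S -> R', by restriction of scalars. The gamma functions are
    R-linear, so N is an A-brace and e_i N is a subbrace and an A_i-brace. The
    proposition therefore reduces to maps of rings: from Z_p(lam_i) to A_i for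
    the first part, and from Z_p(lam), with lam = gcd(lam_i), to the product A
    of the A_i for the second.

    Such maps come from Hensel's lemma. Choose f in Z[X], monic of degree lam,
    whose reduction modulo p is irreducible and divides X^(p^lam) - X
    [exists_unramified_poly]. On one side, K = Q_p(x) for a root x of f is
    unramified of degree lam and its ring of integers is Z_p[x], which is Z_p[X]
    modulo f; a map from it to a ring killed by a power of p is the choice of a
    root of f there [roi_rmorphism]. On the other side, if a finite local ring
    has a residue field with p^(lam mu) elements, then f has a simple
    root there [residual_simple_root], which lifts because the maximal
    ideal consists of nilpotent elements [Hensel_nilpotent, local_nilpotent].

    Everything about K is derived from two facts. First, 1/p is not integral over
    Z_p [padic_pinv_not_integral]. Second, if g in Z_p[X] has degree less than
    lam and is nonzero modulo p, then g(x) w(x) = 1 + p v(x) for some w and v in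
    Z_p[X] [primitive_at_root]. Together they show that g(x) is nonzero (so f is
    irreducible over Q_p), that an element of K with a true denominator is not
    integral, and that an integer of K not divisible by p is a unit, so that p
    generates the unique maximal ideal.

    The orders are counted as follows: p_i is nilpotent in A_i, so a power of p_i
    kills e_i N, a finite abelian group; and if q^n = #|N| also kills e_i N,
    which is nonzero because A acts faithfully, then p_i = q. *)

(** * p-adic integers *)

Lemma natr_Zp_eq m a b : (1 < m)%N ->
  (a%:R == b%:R :> 'Z_m) = (a == b %[mod m])%N.
Proof.
by move=> m_gt1; rewrite -val_eqE /= !val_Zp_nat.
Qed.

Section PadicArithmetic.
Variables (p : nat) (pr : prime p).
Local Notation Zp := (padic_int pr).

Lemma padic_natE k n : (k%:R : Zp) n = k%:R.
Proof. by elim: k => // k IH; rewrite -!natr1 -IH. Qed.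

Lemma padic_trunc_eq0 (z : Zp) n : (z n == 0) = (p ^ n.+1 %| z n)%N.
Proof.
by rewrite -{1}[z n]natr_Zp (natr_Zp_eq _ 0) ?(padic_mod_gt1 pr) // mod0n.
Qed.

Lemma padic_trunc_dvd (z : Zp) n : z 0%N = 0 -> (p %| z n)%N.
Proof.
move=> z0; have := padic_val_mod z (leq0n n).
rewrite z0 => /eqP; rewrite (natr_Zp_eq _ 0) ?(padic_mod_gt1 pr) //.
by rewrite expn1 mod0n.
Qed.

(** The quotient has n-th component z_(n+1) / p: dividing by p costs one digit
    of precision, hence the shift. *)
Lemma padic_dvdp (z : Zp) : z 0%N = 0 -> exists w : Zp, z = p%:R * w.
Proof.
move=> z0; have dvd n := padic_trunc_dvd n z0.
have p_gt0 := prime_gt0 pr.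
have compat n : (((z n.+2 %/ p)%:R : 'Z_(p ^ n.+2)) : nat)%:R
                  = (z n.+1 %/ p)%:R :> 'Z_(p ^ n.+1).
  rewrite -[LHS]/(padic_red _) (padic_redE pr); apply/eqP.
  rewrite natr_Zp_eq ?(padic_mod_gt1 pr) // -(eqn_pmul2r p_gt0).
  rewrite !muln_modl -!expnSr !divnK //.
  rewrite -natr_Zp_eq ?(padic_mod_gt1 pr) // natr_Zp //.
  exact/eqP/padic_compat.
exists (@PadicInt p pr (fun n => (z n.+1 %/ p)%:R) compat).
apply: padic_ext => n; rewrite /= padic_natE -natrM mulnC divnK //.
exact/esym/padic_compat.
Qed.

(** Each z_n is coprime to p, hence invertible, and the inverses are compatible
    because inverses are unique. *)
Lemma padic_unitP (z : Zp) : z 0%N != 0 -> exists w : Zp, w * z = 1.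
Proof.
move=> z0.
have co n : coprime (p ^ n.+1) (z n).
  rewrite coprime_pexpl // prime_coprime //; apply: contraNN z0 => pz.
  rewrite -(padic_val_mod z (leq0n n)) (natr_Zp_eq _ 0) ?(padic_mod_gt1 pr) //.
  by rewrite expn1 mod0n.
have un n : z n \is a GRing.unit by rewrite -[z n]natr_Zp unitZpE ?(padic_mod_gt1 pr).
have compat n : ((z n.+1)^-1 : nat)%:R = (z n)^-1 :> 'Z_(p ^ n.+1).
  rewrite -[LHS]/(padic_red _); apply: (mulIr (un n)); rewrite mulVr ?un //.
  have {1}<- : padic_red (z n.+1) = z n by exact: padic_compat.
  by rewrite -(padic_redM pr) mulVr ?un //; exact: (padic_redE pr _ 1).
exists (@PadicInt p pr (fun n => (z n)^-1) compat).
by apply: padic_ext => n; rewrite /= mulVr ?un.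
Qed.

Lemma padic_p_neq0 : p%:R != 0 :> Zp.
Proof.
apply/eqP => /(congr1 (fun z : Zp => z 1%N)) /eqP.
rewrite padic_natE (natr_Zp_eq _ 0) ?(padic_mod_gt1 pr) // mod0n modn_small.
  by rewrite eqn0Ngt prime_gt0.
by rewrite -[X in (X < _)%N]expn1 ltn_exp2l // prime_gt1.
Qed.

(** Every nonzero p-adic integer is a unit times a power of p; the induction is
    on a precision n at which z is visibly nonzero. *)
Lemma padic_assoc_pow (z : Zp) : z != 0 ->
  exists (w : Zp) (k : nat), w * z = p%:R ^+ k.
Proof.
move=> nz; have [n zn] : exists n, z n != 0.
  apply/not_existsP => h; move/eqP: nz; apply; apply: padic_ext => n.
  by apply/eqP/negPn/negP/h.
elim: n z zn {nz} => [|n IH] z zn.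
  by have [w wz] := padic_unitP zn; exists w, 0%N.
have [z0|z0] := eqVneq (z 0%N) 0; last first.
  by have [w wz] := padic_unitP z0; exists w, 0%N.
have [w zw] := padic_dvdp z0.
have wn : w n != 0.
  apply: contraNN zn => /eqP wn0; rewrite zw /= padic_natE.
  have : (p ^ n.+1 %| w n.+1)%N.
    have := padic_compat w n; rewrite wn0 => /eqP.
    by rewrite (natr_Zp_eq _ 0) ?(padic_mod_gt1 pr) // mod0n.
  rewrite -{2}[w n.+1]natr_Zp -natrM (natr_Zp_eq _ 0) ?(padic_mod_gt1 pr) // mod0n.
  by move=> h; have := dvdn_mul (dvdnn p) h; rewrite -expnS.
have [v [k vw]] := IH w wn.
by exists v, k.+1; rewrite zw mulrCA vw exprS.
Qed.

(** Powers of p suffice as denominators in Q_p. *)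
Lemma padic_field_denom (c : padic_field pr) :
  exists (k : nat) (a : Zp), p%:R ^+ k * c = tofrac a.
Proof.
have [n [d [d0 cd]]] : exists (n d : Zp), d != 0 /\ c * tofrac d = tofrac n.
  elim/quotW: c => c; exists (frac c).1, (frac c).2.
  split; first exact: denom_ratioP.
  have -> (x y : padic_field pr) : x * y = FracField.mul x y by [].
  apply/eqP; rewrite !piE /FracField.mulf !numden_Ratio ?oner_neq0 ?denom_ratioP //.
  by rewrite FracField.equivfE !numden_Ratio ?mulr1 ?oner_neq0 ?denom_ratioP // mulrC.
have [w [k wd]] := padic_assoc_pow d0.
exists k, (w * n); rewrite -(rmorph_nat (@tofrac Zp)) -rmorphXn /= -wd !rmorphM /=.
by rewrite -mulrA (mulrC _ c) cd.
Qed.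

(** A ring killed by p^(n+1) is a Z_p-algebra through Z / p^(n+1). This is used
    for F_p, which gives reduction modulo p, and for finite local rings. *)
Lemma padic_rmorphism (A : comNzRingType) n :
  (p ^ n.+1)%:R = 0 :> A -> exists phi : {rmorphism Zp -> A},
    forall z, phi z = (z n : nat)%:R.
Proof.
move=> char_A; pose phi (z : Zp) : A := (z n : nat)%:R.
have natr_mod a : (a %% p ^ n.+1)%:R = a%:R :> A.
  by rewrite [in RHS](divn_eq a (p ^ n.+1)) natrD natrM char_A mulr0 add0r.
have phiD : {morph phi : x y / x + y}.
  move=> x y; rewrite /phi -natrD -natr_mod -[RHS]natr_mod /=.
  move: (x n : nat) (y n : nat) => a b.
  by rewrite Zp_cast ?(padic_mod_gt1 pr) // modn_mod.
have phiM : {morph phi : x y / x * y}.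
  move=> x y; rewrite /phi -natrM -natr_mod -[RHS]natr_mod /=.
  move: (x n : nat) (y n : nat) => a b.
  by rewrite Zp_cast ?(padic_mod_gt1 pr) // modn_mod.
have phi1 : phi 1 = 1.
  by rewrite /phi /= modn_small // Zp_cast ?(padic_mod_gt1 pr).
have phiB : zmod_morphism phi.
  by move=> x y; apply/(addIr (phi y)); rewrite -phiD !subrK.
pose c1 := GRing.isZmodMorphism.Build _ _ phi phiB.
pose c2 := GRing.isMonoidMorphism.Build _ _ phi (phi1, phiM).
pose phiR : {rmorphism Zp -> A} := HB.pack phi c1 c2.
by exists phiR.
Qed.
End PadicArithmetic.

(** * Defining polynomials of unramified extensions *)

Lemma map_poly_intr (R S : nzRingType) (j : {rmorphism R -> S}) (u : {poly int}) :
  map_poly j (map_poly intr u) = map_poly intr u.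
Proof.
by rewrite -map_poly_comp; apply: eq_map_poly => c /=; rewrite rmorph_int.
Qed.

Section LiftFp.
Variables (p : nat) (pr : prime p).

(** Least residues lift 1 to 1, so monic polynomials have monic lifts. *)
Definition lift_Fp (u : {poly 'F_p}) : {poly int} :=
  \poly_(i < size u) ((u`_i)%R : nat)%:Z.

Lemma lift_FpK u : map_poly intr (lift_Fp u) = u.
Proof.
apply/polyP=> i; rewrite coef_map coef_poly /=; case: ltnP => hi.
  by rewrite -pmulrn natr_Zp.
by rewrite rmorph0 nth_default.
Qed.

Lemma lift_Fp_monic u : u \is monic ->
  lift_Fp u \is monic /\ size (lift_Fp u) = size u.
Proof.
move=> mon_u; have u_gt0 : (0 < size u)%N.
  by rewrite lt0n size_poly_eq0 monic_neq0.
have lead1 : (lift_Fp u)`_(size u).-1 = 1.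
  rewrite coef_poly prednK // leqnn -/(lead_coef u) (monicP mon_u) /=.
  by rewrite modn_small.
have size_lift : size (lift_Fp u) = size u.
  apply/eqP; rewrite eqn_leq size_poly leqNgt; apply/negP=> h.
  have := lead1; rewrite nth_default //.
  by move: h; case: (size u) u_gt0.
by split=> //; rewrite monicE lead_coefE size_lift lead1.
Qed.

Lemma poly_int_eq0_modp (u : {poly int}) :
  map_poly intr u = 0 :> {poly 'F_p} -> exists w : {poly int}, u = p%:R *: w.
Proof.
move=> u0; exists (\poly_(i < size u) (u`_i %/ p)%Z).
apply/polyP=> i; rewrite coefZ coef_poly; case: ltnP => hi; last first.
  by rewrite nth_default ?mulr0.
rewrite mulrC natz divzK // (dvdz_pcharf (pchar_Fp pr)).
by have := congr1 (fun v : {poly _} => v`_i) u0; rewrite coef_map coef0 /= => ->.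
Qed.

End LiftFp.

(** The minimal polynomial over F_p of a generator of the multiplicative group
    of the field with q = p^lam elements. It divides X^q - X because every
    element of that field is a root of X^q - X. *)
Lemma exists_irreducible_Fp p lam : prime p -> (0 < lam)%N ->
  exists u : {poly 'F_p}, [/\ u \is monic, size u = lam.+1,
    irreducible_poly u & u %| 'X^(p ^ lam) - 'X].
Proof.
move=> pr lam_gt0.
have [F0 pcharF cardF] := pPrimePowerField pr lam_gt0.
pose F : fieldExtType 'F_p := pPrimeCharType pcharF.
have dimF : \dim {: F} = lam.
  by rewrite (pprimeChar_dimf pcharF) cardF pfactorK.
have /cyclicP[z genz] := field_unit_group_cyclic [set: {unit F0}].
pose x : F := val z.
have gen_x : <<1; x>>%VS = {: F}%VS.
  apply/vspaceP=> y; rewrite memvf; have [->|ny] := eqVneq y 0; first exact: mem0v.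
  have : finField_unit (ny : (y : F0) != 0) \in <[z]>%g by rewrite -genz inE.
  case/cycleP=> i /(congr1 val) /= ->.
  rewrite FinRing.val_unitX; apply: (@rpredX _ <<1; x>>%AS i x).
  exact: memv_adjoin.
have /polyOver1P[v Dv] := minPolyOver 1 x.
have mon_v : v \is monic by rewrite -(map_monic (in_alg F)) -Dv monic_minPoly.
have sz_v : size v = lam.+1.
  rewrite -(size_map_poly (in_alg F)) -Dv size_minPoly adjoin_degreeE.
  by rewrite gen_x dimF dimv1 divn1.
have irr_v : irreducible_poly v.
  split=> [|q nq qv]; first by rewrite sz_v ltnS.
  have : map_poly (in_alg F) q %| minPoly 1 x by rewrite Dv dvdp_map.
  have q1 : map_poly (in_alg F) q \is a polyOver 1%AS by apply/polyOver1P; exists q.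
  case/(minPoly_irr q1)/orP; rewrite ?Dv ?eqp_map //.
  by rewrite -(rmorph1 (map_poly (in_alg F))) eqp_map -size_poly_eq1 (negPf nq).
exists v; split=> //.
rewrite -(dvdp_map (in_alg F)) -Dv rmorphB /= map_polyXn map_polyX.
apply: minPoly_dvdp; first by rewrite rpredB ?rpredX ?polyOverX.
by rewrite rootE !hornerE -cardF (expf_card (x : F0)) subrr.
Qed.

(** The defining polynomial is taken over Z, so that it maps to every ring; the
    congruence modulo p records that its reduction splits over any field whose
    degree over F_p is a multiple of lam. *)
Lemma exists_unramified_poly p lam : prime p -> (0 < lam)%N ->
  exists f h w : {poly int}, [/\ f \is monic, size f = lam.+1,
    irreducible_poly (map_poly intr f : {poly 'F_p}) &
    f * h = 'X^(p ^ lam) - 'X + p%:R *: w].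
Proof.
move=> pr /(exists_irreducible_Fp pr)[u [mon_u sz_u irr_u /dvdpP[v uv]]].
have [mon_f sz_f] := lift_Fp_monic mon_u.
exists (lift_Fp u), (lift_Fp v).
have [w Dw] : exists w : {poly int},
    lift_Fp u * lift_Fp v - ('X^(p ^ lam) - 'X) = p%:R *: w.
  apply: (poly_int_eq0_modp pr).
  by rewrite !(rmorphB, rmorphM) /= map_polyXn map_polyX !lift_FpK uv mulrC subrr.
exists w; split; rewrite ?sz_f ?lift_FpK //.
by rewrite -Dw addrC subrK.
Qed.

(** * Reduction modulo p of polynomials over Z_p *)

Section Residue.
Variables (p : nat) (pr : prime p).
Local Notation Zp := (padic_int pr).

Lemma Fp_char_pow1 : (p ^ 1)%:R = 0 :> 'F_p.
Proof. by rewrite expn1 pchar_Fp_0. Qed.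

Definition residue : {rmorphism Zp -> 'F_p} :=
  projT1 (cid (padic_rmorphism pr Fp_char_pow1)).

Lemma residue_eq0 (z : Zp) : residue z = 0 -> exists w, z = p%:R * w.
Proof.
move=> z0; apply: padic_dvdp; move: z0.
rewrite (projT2 (cid (padic_rmorphism pr Fp_char_pow1)) z) => /eqP.
rewrite -(dvdn_pcharf (pchar_Fp pr)) => h.
by apply/eqP; rewrite padic_trunc_eq0; move: (nat_of_ord (z 0%N)) h => a; rewrite expn1.
Qed.

Local Notation red := (map_poly residue).

Lemma red_eq0 (g : {poly Zp}) : red g = 0 -> exists h, g = p%:R *: h.
Proof.
move=> g0.
have /choice[h hP] i : exists w : Zp, g`_i = p%:R * w.
  by apply: residue_eq0; rewrite -coef_map g0 coef0.
exists (\poly_(i < size g) h i).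
apply/polyP=> i; rewrite coefZ coef_poly; case: ltnP => hi; first exact: hP.
by rewrite nth_default ?mulr0.
Qed.

Lemma red_lift (u : {poly 'F_p}) : exists g : {poly Zp}, red g = u.
Proof.
exists (map_poly intr (lift_Fp u)); rewrite -map_poly_comp.
rewrite -[RHS]lift_FpK; apply: eq_map_poly => c /=; exact: rmorph_int.
Qed.

(** Q_p enters only as a field K containing Z_p in which powers of p clear
    denominators: keeping K abstract hides the construction of fractions from
    unification. *)
Section Denominators.
Variables (K : fieldType) (j : {rmorphism Zp -> K}).
Hypotheses (j_inj : injective j)
  (j_denom : forall c : K, exists (k : nat) (a : Zp), p%:R ^+ k * c = j a).

Lemma padic_poly_denom (g : {poly K}) :
  exists (k : nat) (h : {poly Zp}), p%:R ^+ k *: g = map_poly j h.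
Proof.
elim/poly_ind: g => [|g c [k [h Dh]]].
  by exists 0%N, 0; rewrite scaler0 map_poly0.
have [l [a Da]] := j_denom c.
exists (k + l)%N, (p%:R ^+ l *: (h * 'X) + (p%:R ^+ k * a)%:P).
rewrite rmorphD /= map_polyZ rmorphM /= map_polyX map_polyC /=.
rewrite -Dh rmorphM /= -Da !rmorphXn /= !rmorph_nat.
rewrite scalerDr; congr (_ + _).
  by rewrite -!scalerAl scalerA -exprD addnC.
by rewrite -mul_polyC -polyCM exprD mulrA.
Qed.

(** With a minimal denominator p^k the numerator h is nonzero modulo p, unless
    k = 0: otherwise a factor p would cancel. *)
Lemma padic_poly_clear (g : {poly K}) :
  exists (k : nat) (h : {poly Zp}), [/\ p%:R ^+ k *: g = map_poly j h,
    (size h <= size g)%N & k = 0%N \/ red h <> 0].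
Proof.
have p0 : p%:R != 0 :> K.
  by rewrite -(rmorph_nat j) -(rmorph0 j) (inj_eq j_inj) padic_p_neq0.
have [k [h Dh]] := padic_poly_denom g.
have sz_h : (size h <= size g)%N.
  have <- : size (map_poly j h) = size h.
    by apply: size_map_inj_poly; rewrite ?rmorph0.
  by rewrite -Dh size_scale ?expf_neq0.
elim: k h Dh sz_h => [|k IH] h Dh sz_h; first by exists 0%N, h; split=> //; left.
have [/red_eq0[h1 Dh1]|nh] := pselect (red h = 0); last first.
  by exists k.+1, h; split=> //; right.
apply: (IH h1).
  apply: (scalerI p0); rewrite scalerA -exprS Dh Dh1 map_polyZ.
  by rewrite /= rmorph_nat.
have p0' := padic_p_neq0 pr.
by rewrite -(size_scale h1 p0') -Dh1.
Qed.

End Denominators.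
End Residue.

(** * Values of primitive polynomials at a root of f *)

(** Z_p is integrally closed at 1/p: if y = 1/p is a root of a monic polynomial
    of degree n over Z_p, multiplying by p^n gives 1 + p c = 0 in Z_p, which is
    absurd modulo p. Integral closure enters below only through this fact. *)
Lemma padic_pinv_not_integral (p : nat) (pr : prime p) (K : fieldType)
    (j : {rmorphism padic_int pr -> K}) (y : K) :
  injective j -> p%:R * y = 1 -> ~ integralOver j y.
Proof.
move=> j_inj py1 [q mon_q /eqP].
have low (l : {poly padic_int pr}) n : (size l <= n)%N ->
    exists c, p%:R ^+ n * (map_poly j l).[y] = p%:R * j c.
  move=> sz_l; exists (\sum_(i < n) l`_i * p%:R ^+ (n - i).-1).
  rewrite (@horner_coef_wide _ n); last first.
    by rewrite size_map_inj_poly ?rmorph0.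
  rewrite rmorph_sum !mulr_sumr; apply: eq_bigr => i _ /=.
  rewrite coef_map rmorphM rmorphXn rmorph_nat /= mulrCA [RHS]mulrCA.
  congr (_ * _); rewrite -exprS prednK ?subn_gt0 //.
  rewrite -{1}(subnK (ltnW (ltn_ord i))) exprD -mulrA -exprMn.
  by rewrite py1 expr1n mulr1.
have [n sz_q] : exists n, size q = n.+1.
  by exists (size q).-1; rewrite prednK // lt0n size_poly_eq0 monic_neq0.
have Dq : q = 'X^n + (q - 'X^n) by rewrite addrC subrK.
have [|c Dc] := low (q - 'X^n) n.
  apply/leq_sizeP=> i; rewrite leq_eqVlt coefB coefXn => /predU1P[<-|n_lt].
    rewrite eqxx; move/monicP: mon_q; rewrite lead_coefE sz_q /= => ->.
    by rewrite subrr.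
  by rewrite gtn_eqF // subr0 nth_default ?sz_q.
rewrite Dq rmorphD /= map_polyXn hornerD hornerXn => /(congr1 ( *%R (p%:R ^+ n))).
rewrite mulr0 mulrDr Dc -exprMn py1 expr1n -(rmorph_nat j) -rmorphM.
rewrite -(rmorph1 j) -rmorphD -(rmorph0 j) => /j_inj.
move=> /(congr1 (residue pr)); rewrite rmorphD rmorphM rmorph1 rmorph0 rmorph_nat.
by rewrite pchar_Fp_0 ?mul0r ?addr0 // => /eqP; rewrite oner_eq0.
Qed.

Section UnramifiedRoot.
Variables (p : nat) (pr : prime p).
Local Notation Zp := (padic_int pr).
Variables (lam : nat) (f : {poly int}).
Hypotheses (f_monic : f \is monic) (sz_f : size f = lam.+1)
  (f_irr : irreducible_poly (map_poly intr f : {poly 'F_p})).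
Local Notation red := (map_poly (residue pr)).

(** Bezout's identity between g and f modulo p, lifted to Z_p: g is nonzero
    modulo p and of smaller degree than f, which is irreducible modulo p. *)
Lemma Bezout_modp (g : {poly Zp}) : red g <> 0 -> (size g <= lam)%N ->
  exists w u v : {poly Zp}, g * w = 1 + p%:R *: v + u * map_poly intr f.
Proof.
move=> /eqP nz_g sz_g; have irr := f_irr.
set fb := (map_poly intr f : {poly 'F_p}) in irr.
have sz_fb : size fb = lam.+1.
  by rewrite size_map_poly_id0 // (monicP f_monic) oner_eq0.
have : coprimep (red g) fb.
  rewrite coprimep_sym; apply: contraLR (leq_gcdpr fb nz_g) => /irr/implyP.
  rewrite dvdp_gcdl -ltnNge /= => /eqp_size->; rewrite sz_fb ltnS.
  exact: leq_trans (size_poly _ _) sz_g.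
case/Bezout_eq1_coprimepP=> -[w1 u1] /= uw.
have [w Dw] := red_lift pr w1; have [u Du] := red_lift pr u1.
have [|v Dv] := @red_eq0 _ pr (g * w - 1 + u * map_poly intr f).
  rewrite !(rmorphB, rmorphD, rmorphM) /= rmorph1 Dw Du -map_poly_comp.
  have -> : map_poly (residue pr \o intr) f = fb.
    by apply: eq_map_poly => c /=; rewrite rmorph_int.
  by rewrite (mulrC _ w1) addrAC uw subrr.
by exists w, (- u), v; rewrite -Dv mulNr [1 + _]addrA addrK addrC subrK.
Qed.

Section InField.
Variables (K : fieldType) (j : {rmorphism Zp -> K}).
Hypothesis (j_inj : injective j).
Variables (x : K).
Hypothesis (fx0 : root (map_poly intr f) x).
Local Notation "g ^j" := (map_poly j g) (at level 2).

Lemma primitive_at_root (g : {poly Zp}) : red g <> 0 -> (size g <= lam)%N ->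
  exists w v : {poly Zp}, g^j.[x] * w^j.[x] = 1 + p%:R * v^j.[x].
Proof.
move=> nz_g /(Bezout_modp nz_g)[w [u [v /(congr1 (fun g => g^j.[x]))]]].
rewrite rmorphM hornerM rmorphD rmorphM hornerD hornerM /= map_poly_intr.
rewrite (rootP fx0) mulr0 addr0 rmorphD /= map_polyZ hornerD hornerZ /=.
by rewrite rmorph1 hornerC rmorph_nat => E; exists w, v.
Qed.

Lemma integral_at_root (g : {poly Zp}) : integralOver j g^j.[x].
Proof.
apply: integral_horner; last first.
  exists (map_poly intr f); first exact: monic_map.
  by rewrite map_poly_intr.
apply/integral_poly => i; rewrite coef_map; exact: integral_id.
Qed.

(** Otherwise 1/p would be the value of -g at x, hence integral. *)
Lemma nonzero_p_at_root (g : {poly Zp}) : 1 + p%:R * g^j.[x] != 0.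
Proof.
apply/eqP=> /eqP; rewrite addrC addr_eq0 => /eqP E.
apply: (@padic_pinv_not_integral p pr K j (- g^j.[x])) => //.
  by rewrite mulrN E opprK.
exact/integral_opp/integral_at_root.
Qed.

Lemma primitive_neq0 (g : {poly Zp}) : red g <> 0 -> (size g <= lam)%N ->
  g^j.[x] != 0.
Proof.
move=> nz_g /(primitive_at_root nz_g)[w [v gw]].
by apply: contraNneq (nonzero_p_at_root v) => g0; rewrite -gw g0 mul0r.
Qed.

End InField.

(** As above, Q stands for Q_p. *)
Section OverQp.
Variables (Q : fieldType) (j0 : {rmorphism Zp -> Q}).
Hypotheses (j0_inj : injective j0)
  (j0_denom : forall c : Q, exists (k : nat) (a : Zp), p%:R ^+ k * c = j0 a).
Variables (K : fieldType) (i : {rmorphism Q -> K}) (x : K).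
Hypothesis (fx0 : root (map_poly intr f) x).

(** Gauss's lemma in the form needed: a nonzero polynomial over Q_p of degree
    less than lam, once primitive, does not vanish at x. So f is the
    minimal polynomial of each of its roots. *)
Lemma root_minimal (g : {poly Q}) : root (map_poly i g) x -> g != 0 ->
  (lam < size g)%N.
Proof.
move=> gx0 nz_g; rewrite ltnNge; apply/negP=> sz_g.
wlog mon_g : g gx0 nz_g sz_g / g \is monic.
  move=> IH; have nz : (lead_coef g)^-1 != 0 by rewrite invr_eq0 lead_coef_eq0.
  apply: (IH ((lead_coef g)^-1 *: g)); rewrite ?scaler_eq0 ?negb_or ?nz //.
  - by rewrite map_polyZ rootE hornerZ (rootP gx0) mulr0.
  - by rewrite size_scale.
  - by rewrite monicE lead_coefZ mulVf // lead_coef_eq0.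
have [k [h [Dh sz_h prim]]] := padic_poly_clear j0_inj j0_denom g.
have ij_inj : injective (i \o j0) by move=> a b /= /fmorph_inj/j0_inj.
have nz_h : red h <> 0.
  case: prim => // k0; rewrite k0 expr0 scale1r in Dh.
  move=> /(congr1 (fun u : {poly _} => u`_(size g).-1)); rewrite coef_map coef0 /=.
  have : j0 h`_(size g).-1 = 1 by rewrite -coef_map -Dh; apply/monicP.
  rewrite -(rmorph1 j0) => /j0_inj->; rewrite rmorph1 => /eqP.
  by rewrite oner_eq0.
have := primitive_neq0 ij_inj fx0 nz_h (leq_trans sz_h sz_g).
by case/negP; rewrite map_poly_comp /= -Dh map_polyZ hornerZ (rootP gx0) mulr0.
Qed.

(** f is monic, so g can be divided by f over Z_p; the remainder has degree less
    than lam and vanishes at x, so it is 0 by minimality. *)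
Lemma root_int_dvd (g : {poly Zp}) : root (map_poly (i \o j0) g) x ->
  exists h, g = h * map_poly intr f.
Proof.
set F := map_poly intr f : {poly Zp} => gx0.
have mon_F : F \is monic by apply: monic_map.
have sz_F : size F = lam.+1.
  by rewrite size_map_poly_id0 // (monicP f_monic) oner_eq0.
have Dg := Pdiv.RingMonic.rdivp_eq mon_F g.
exists (Pdiv.Ring.rdivp g F); rewrite [LHS]Dg.
suff -> : Pdiv.Ring.rmodp g F = 0 by rewrite addr0.
set r := Pdiv.Ring.rmodp g F in Dg *.
have sz_r : (size r <= lam)%N.
  by rewrite -ltnS -sz_F Pdiv.Ring.ltn_rmodpN0 // monic_neq0.
have inj_red : injective (map_poly j0) by apply: map_inj_poly; rewrite ?rmorph0.
apply: inj_red; rewrite map_poly0; apply/eqP/negPn/negP=> nz_r.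
suff rx0 : root (map_poly i (map_poly j0 r)) x.
  have := root_minimal rx0 nz_r.
  by rewrite ltnNge (leq_trans (size_poly _ _) sz_r).
move: gx0; rewrite [in X in X -> _]Dg !rootE rmorphD rmorphM hornerD hornerM /=.
by rewrite map_poly_intr (rootP fx0) mulr0 add0r map_poly_comp.
Qed.

End OverQp.
End UnramifiedRoot.

(** * The ring of integers generated by a root of f *)

Section RingOfIntegers.
Variables (p : nat) (pr : prime p).
Local Notation Zp := (padic_int pr).
Local Notation Qp := (padic_field pr).
Variables (lam : nat) (f : {poly int}).
Hypotheses (f_monic : f \is monic) (sz_f : size f = lam.+1)
  (f_irr : irreducible_poly (map_poly intr f : {poly 'F_p})).
Local Notation red := (map_poly (residue pr)).

Lemma tofrac_inj : injective (@tofrac Zp).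
Proof. by move=> x y /eqP; rewrite tofrac_eq => /eqP. Qed.

Variables (L : fieldExtType Qp) (x : L).
Hypotheses (fx0 : root (map_poly intr f) x)
  (x_gen : forall y : L, exists q : {poly Qp}, y = (map_poly (in_alg L) q).[x]).
Local Notation O := (ring_of_integers L).

Let emb : {rmorphism Zp -> L} := padic_emb L.
Local Notation "g @x" := (map_poly emb g).[x] (at level 2).

Let emb_inj : injective emb.
Proof. by move=> a b /(fmorph_inj (in_alg L))/tofrac_inj. Qed.

(** Coordinates of y in the basis 1, x, ..., x^(lam-1) of L over Q_p, with their
    common denominator p^k in lowest terms. *)
Lemma p_power_coordinates (y : L) : exists (k : nat) (h : {poly Zp}),
  [/\ p%:R ^+ k * y = h@x, (size h <= lam)%N & k = 0%N \/ red h <> 0].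
Proof.
have [q ->] := x_gen y.
set F := map_poly intr f : {poly Qp}.
have mon_F : F \is monic by apply: monic_map.
have sz_F : size F = lam.+1.
  by rewrite size_map_poly_id0 // (monicP f_monic) oner_eq0.
have [k [h [Dh sz_h prim]]] :=
  padic_poly_clear tofrac_inj (@padic_field_denom p pr) (q %% F).
exists k, h; split=> //; last first.
  by apply: leq_trans sz_h _; rewrite -ltnS -sz_F ltn_modpN0 // monic_neq0.
have -> : map_poly emb h = map_poly (in_alg L) (p%:R ^+ k *: (q %% F)).
  by rewrite Dh -map_poly_comp.
rewrite [in LHS](divp_eq q F) rmorphD rmorphM hornerD hornerM /=.
have -> : map_poly (in_alg L) F = map_poly intr f.
  rewrite -map_poly_comp; apply: eq_map_poly => c.
  exact: (rmorph_int (in_alg L)).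
rewrite (rootP fx0) mulr0 add0r map_polyZ hornerZ; congr (_ * _).
by rewrite (rmorphXn (in_alg L)) (rmorph_nat (in_alg L)).
Qed.

(** The ring of integers is Z_p[x]: if p^k y = h(x) with k > 0 in lowest terms,
    then h(x) w(x) = 1 + p v(x), so 1/p = p^(k-1) y w(x) - v(x) would be
    integral together with y. *)
Lemma integral_coordinates (y : L) : integralOver emb y ->
  exists2 h : {poly Zp}, (size h <= lam)%N & y = h@x.
Proof.
move=> int_y; have [[|k] [h [Dh sz_h prim]]] := p_power_coordinates y.
  by exists h; rewrite // -Dh mul1r.
case: prim => // nz_h.
have [w [v hw]] := primitive_at_root f_monic sz_f f_irr emb fx0 nz_h sz_h.
case: (@padic_pinv_not_integral p pr L emb (p%:R ^+ k * y * w@x - v@x)) => //.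
  by rewrite mulrBr !mulrA -exprS Dh hw addrK.
apply: integral_sub; last exact: (integral_at_root f_monic emb fx0).
apply: integral_mul; last exact: (integral_at_root f_monic emb fx0).
apply: integral_mul => //; rewrite -(rmorph_nat emb) -rmorphXn; exact: integral_id.
Qed.

Fact roi_eval_subproof (h : {poly Zp}) : h@x \in @integral_pred p pr L.
Proof. exact/asboolP/(integral_at_root f_monic emb fx0). Qed.

Definition roi_eval (h : {poly Zp}) : O := RingOfIntegers (roi_eval_subproof h).

Lemma roi_evalE (z : O) : exists2 h : {poly Zp}, (size h <= lam)%N & z = roi_eval h.
Proof.
have /asboolP/integral_coordinates[h sz_h Dh] := roiP z.
by exists h => //; apply: val_inj.
Qed.

Lemma roi_primitive_Bezout (h : {poly Zp}) : red h <> 0 -> (size h <= lam)%N ->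
  exists w v, roi_eval h * w = 1 + p%:R * v.
Proof.
move=> nz_h sz_h.
have [w [v hw]] := primitive_at_root f_monic sz_f f_irr emb fx0 nz_h sz_h.
exists (roi_eval w), (roi_eval v); apply: val_inj.
by rewrite rmorphM rmorphD rmorphM rmorph1 rmorph_nat.
Qed.

Lemma roi_p_not_unit (v : O) : p%:R * v <> 1.
Proof.
move=> /(congr1 val); rewrite rmorphM rmorph_nat rmorph1 /= => pv1.
apply: (@padic_pinv_not_integral p pr L emb (val v)) => //.
by have /asboolP := roiP v.
Qed.

(** Write z = h(x). If h vanishes modulo p then p divides z. Otherwise z is
    invertible modulo p, and z^-1 cannot have a denominator p^k with k > 0: its
    numerator g(x) would be invertible modulo p too, whereas g(x) z = p^k. *)
Lemma roi_dvdp_or_unit (z : O) : (exists v, z = v * p%:R) \/ exists w, w * z = 1.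
Proof.
have [h sz_h Dz] := roi_evalE z.
have [/red_eq0[h1 Dh1]|nz_h] := pselect (red h = 0).
  left; exists (roi_eval h1); rewrite Dz Dh1; apply: val_inj.
  by rewrite rmorphM rmorph_nat /= map_polyZ hornerZ (rmorph_nat emb) mulrC.
right; have [w [v zw]] := roi_primitive_Bezout nz_h sz_h.
have nz_z : val z != 0.
  rewrite Dz /=; exact: (primitive_neq0 f_monic sz_f f_irr emb_inj fx0).
have [k [g [Dg sz_g prim]]] := p_power_coordinates (val z)^-1.
have Dg' : roi_eval g * z = p%:R ^+ k.
  apply: val_inj; rewrite [RHS]rmorphXn rmorph_nat.
  by transitivity (g@x * val z); [exact: rmorphM | rewrite -Dg divfK].
case: k prim Dg' {Dg} => [|k] prim Dg; first by exists (roi_eval g).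
case: prim => // nz_g; have [w' [v' gw]] := roi_primitive_Bezout nz_g sz_g.
(* Multiplying g w' = 1 + p v' by z w = 1 + p v gives
   p^(k+1) w w' = (1 + p v) (1 + p v'), so p divides 1. *)
case: (@roi_p_not_unit (p%:R ^+ k * w * w' - v - v' - p%:R * v * v')).
have : (roi_eval g * z) * (w * w') = (1 + p%:R * v) * (1 + p%:R * v').
  by rewrite -zw -gw -Dz [roi_eval g * z]mulrC mulrACA.
rewrite Dg exprS; move: (p%:R : O) (p%:R ^+ k : O) => P Q E.
transitivity (P * Q * (w * w') - P * v - P * v' - P * v * (P * v')); first by ring.
by rewrite E; ring.
Qed.

Lemma unramified_generated : unramified L.
Proof.
have p_max : 1 \notin principal_ideal (p%:R : O).
  by apply/asboolP=> -[v /esym]; rewrite mulrC; apply: roi_p_not_unit.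
have sub_p (J : ideal O) : 1 \notin J -> {subset J <= principal_ideal (p%:R : O)}.
  move=> J1 z zJ; have [[v ->]|[w wz]] := roi_dvdp_or_unit z.
    by apply/asboolP; exists v.
  by case/negP: J1; rewrite -wz; apply: ideal_absorb.
split; first by split=> // J _; apply: sub_p.
move=> J [J1 J_max] z; apply/idP/idP; first exact: sub_p.
by apply: J_max => //; apply: sub_p.
Qed.

End RingOfIntegers.

Section RoiMorphism.
Variables (p : nat) (pr : prime p).
Local Notation Zp := (padic_int pr).
Local Notation Qp := (padic_field pr).
Variables (lam : nat) (f : {poly int}).
Hypotheses (f_monic : f \is monic) (sz_f : size f = lam.+1)
  (f_irr : irreducible_poly (map_poly intr f : {poly 'F_p})).
Variables (L : fieldExtType Qp) (x : L).
Hypotheses (fx0 : root (map_poly intr f) x)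
  (x_gen : forall y : L, exists q : {poly Qp}, y = (map_poly (in_alg L) q).[x]).
Local Notation O := (ring_of_integers L).
Local Notation roi_eval := (roi_eval f_monic fx0).

(** Z_p[x] is Z_p[X] modulo f: a polynomial vanishing at x is a multiple of f
    over Z_p, so evaluation at any other root of f is well defined. *)
Lemma roi_rmorphism (A : comNzRingType) (iota : {rmorphism Zp -> A}) (a : A) :
  root (map_poly intr f) a -> inhabited {rmorphism O -> A}.
Proof.
move=> fa0.
have roi_eval_val h : val (roi_eval h) = (map_poly (padic_emb L) h).[x] by [].
have wd g h : roi_eval g = roi_eval h ->
    (map_poly iota g).[a] = (map_poly iota h).[a].
  move=> gh; have : root (map_poly (in_alg L \o @tofrac Zp) (g - h)) x.
    rewrite rootE rmorphB hornerD hornerN subr_eq0; exact/eqP/(congr1 val gh).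
  case/(root_int_dvd f_monic sz_f f_irr (@tofrac_inj p pr)
          (@padic_field_denom p pr) fx0) => u /(congr1 (fun v => (map_poly iota v).[a])).
  rewrite rmorphB hornerD hornerN rmorphM hornerM /= map_poly_intr (rootP fa0) mulr0.
  by move/eqP; rewrite subr_eq0 => /eqP.
have /choice[c cP] (z : O) : exists h, z = roi_eval h.
  by have [h _] := roi_evalE f_monic sz_f f_irr fx0 x_gen z; exists h.
pose phi z := (map_poly iota (c z)).[a].
have phiE h : phi (roi_eval h) = (map_poly iota h).[a] by apply: wd; rewrite -cP.
have evalB g h : roi_eval (g - h) = roi_eval g - roi_eval h.
  by apply: val_inj; rewrite [RHS]rmorphB roi_eval_val rmorphB hornerD hornerN.
have evalM g h : roi_eval (g * h) = roi_eval g * roi_eval h.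
  by apply: val_inj; rewrite [RHS]rmorphM roi_eval_val rmorphM hornerM.
have eval1 : roi_eval 1 = 1.
  by apply: val_inj; rewrite [RHS]rmorph1 roi_eval_val rmorph1 hornerC.
have phiB : zmod_morphism phi.
  by move=> z w; rewrite (cP z) (cP w) -evalB !phiE rmorphB hornerD hornerN.
have phiM : monoid_morphism phi.
  split; first by rewrite -eval1 phiE rmorph1 hornerC.
  by move=> z w; rewrite (cP z) (cP w) -evalM !phiE rmorphM hornerM.
pose m1 := GRing.isZmodMorphism.Build _ _ phi phiB.
pose m2 := GRing.isMonoidMorphism.Build _ _ phi phiM.
pose phiR : {rmorphism O -> A} := HB.pack phi m1 m2.
exact: (inhabits phiR).
Qed.
End RoiMorphism.

(** K is Q_p(x) for a root x of f in the algebraic closure; degree lam comes from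
    the minimality of f. *)
Lemma unramified_ext_of_poly (p : nat) (pr : prime p)
    (Qbar : algebraic_closure (padic_field pr)) (lam : nat) (f : {poly int}) :
    (0 < lam)%N -> f \is monic -> size f = lam.+1 ->
    irreducible_poly (map_poly intr f : {poly 'F_p}) ->
  exists K : unramified_ext Qbar lam,
    forall (A : comNzRingType) (iota : {rmorphism padic_int pr -> A}) (a : A),
    root (map_poly intr f) a ->
    inhabited {rmorphism unramified_integers K -> A}.
Proof.
move=> lam_gt0 f_monic sz_f f_irr.
pose Qp := padic_field pr; pose F := map_poly intr f : {poly Qp}.
have mon_F : F \is monic by apply: monic_map.
have sz_F : size F = lam.+1.
  by rewrite size_map_poly_id0 // (monicP f_monic) oner_eq0.
pose C := acl_field Qbar; pose i := acl_emb Qbar : {rmorphism Qp -> C}.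
have [x Fx0] : exists x : C, root (map_poly i F) x.
  by apply/closed_rootP; rewrite size_map_poly sz_F eqSS -lt0n.
have nz_F : F != 0 by rewrite monic_neq0.
have irr_F : irreducible_poly F.
  apply/(subfx_irreducibleP Fx0 nz_F) => q qx0 nz_q; rewrite sz_F.
  apply: (root_minimal f_monic sz_f f_irr (@tofrac_inj p pr)
            (@padic_field_denom p pr) (i := i) (x := x)) => //.
  by rewrite -(map_poly_intr i).
pose L : fieldExtType Qp := SubFieldExtType Fx0 irr_F.
pose inj : {rmorphism L -> C} := @subfx_inj _ _ i x F.
pose y : L := subfx_root i x F.
have injE a : inj a%:A = i a by apply: subfx_inj_base.
have fy0 : root (map_poly intr f) y.
  rewrite -(fmorph_root inj) map_poly_intr -(map_poly_intr i).
  by rewrite -[inj y]/(subfx_inj (subfx_root i x F)) (subfx_inj_root Fx0 nz_F).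
have y_gen (z : L) : exists q : {poly Qp}, z = (map_poly (in_alg L) q).[y].
  by have [q Dq] := subfxEroot Fx0 nz_F z; exists q.
have dimL : \dim {: L} = lam.
  have -> : lam = (size F).-1 by rewrite sz_F.
  by rewrite dimvf; reflexivity.
have unr : unramified L := unramified_generated f_monic sz_f f_irr fy0 y_gen.
exists (UnramifiedExt injE dimL unr) => A iota a fa0.
exact: (roi_rmorphism f_monic sz_f f_irr fy0 y_gen iota fa0).
Qed.

(** * Hensel's lemma *)

Lemma horner_taylor1 (A : comNzRingType) (g : {poly A}) (a h : A) :
  exists w, g.[a + h] = g.[a] + g^`().[a] * h + w * h ^+ 2.
Proof.
elim/poly_ind: g => [|g c [w Dw]].
  by exists 0; rewrite derivC !horner0 !mul0r !addr0.
exists (w * (a + h) + g^`().[a]).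
rewrite hornerMXaddC Dw derivD derivC addr0 derivM derivX mulr1.
by rewrite !(hornerD, hornerMX, hornerC); ring.
Qed.

(** The Newton step a - g(a) / g'(a) has a value divisible by g(a)^2, so the
    nilpotency exponent of the value decreases until the value is 0. *)
Lemma Hensel_nilpotent (A : comNzRingType) (k : fieldType) (r : {rmorphism A -> k})
    (g : {poly A}) (a : A) :
    (forall b, r b != 0 -> exists c, c * b = 1) ->
    (forall b, r b = 0 -> exists n, b ^+ n = 0) ->
    r g.[a] = 0 -> r g^`().[a] != 0 ->
  exists b, root g b.
Proof.
move=> unit_r nil_r ga0 g'a; have [n gan] := nil_r _ ga0.
have {gan} : g.[a] ^+ n.+1 = 0 by rewrite exprS gan mulr0.
elim: n a ga0 g'a => [|n IH] a ga0 g'a gan.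
  by exists a; rewrite rootE -[_.[_]]expr1 gan.
have [c Dc] := unit_r _ g'a; pose h := - (c * g.[a]).
have rh : r h = 0 by rewrite rmorphN rmorphM ga0 mulr0 oppr0.
have [w Dw] := horner_taylor1 g a h.
have ga2 : g.[a + h] = w * c ^+ 2 * g.[a] ^+ 2.
  by rewrite Dw mulrN mulrA (mulrC _ c) Dc; rewrite /h; ring.
apply: (IH (a + h)).
- by rewrite ga2 expr2 !rmorphM ga0 !mulr0.
- have [w' ->] := horner_taylor1 g^`() a h.
  by rewrite expr2 !rmorphD !rmorphM rh !mulr0 !addr0.
- have -> : g.[a + h] ^+ n.+1 = (w * c ^+ 2) ^+ n.+1 * g.[a] ^+ (n.+2 + n).
    have -> : (n.+2 + n = 2 * n.+1)%N by rewrite mul2n -addnn addSnnS.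
    by rewrite ga2 exprM -exprMn.
  by rewrite exprD gan mul0r mulr0.
Qed.

Lemma dvdp_Xq_subX_iter (k : fieldType) (g : {poly k}) q m :
  g %| 'X^q - 'X -> g %| 'X^(q ^ m) - 'X.
Proof.
move=> gq; elim: m => [|m IH]; first by rewrite expn0 subrr dvdp0.
rewrite expnSr exprM -(subrK ('X^q) (_ ^+ q)) -addrA dvdp_addr //.
by rewrite subrXX dvdp_mulr.
Qed.

(** Over k, f divides X^q - X for q = p^lam, hence also X^#|k| - X, the product
    of all X - a, so f has a root. It is simple because X^q - X has derivative
    -1. *)
Lemma residual_simple_root (p lam m : nat) (f h w : {poly int}) (k : finFieldType) :
    prime p -> (0 < lam)%N -> f \is monic -> (1 < size f)%N ->
    f * h = 'X^(p ^ lam) - 'X + p%:R *: w -> #|k| = (p ^ (lam * m))%N ->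
  exists2 a : k, (map_poly intr f).[a] = 0 & (map_poly intr f)^`().[a] != 0.
Proof.
move=> pr lam_gt0 f_monic sz_f fh card_k.
have char_k := card_finPcharP card_k pr.
set F := map_poly intr f; pose H : {poly k} := map_poly intr h.
have FH : F * H = 'X^(p ^ lam) - 'X.
  rewrite -rmorphM fh rmorphD rmorphB /= map_polyXn map_polyX map_polyZ /=.
  by rewrite rmorph_nat (pcharf0 char_k) scale0r addr0.
have : F %| \prod_(a : k) ('X - a%:P).
  rewrite -finField_genPoly card_k expnM; apply: dvdp_Xq_subX_iter.
  by rewrite -FH dvdp_mulr.
case/dvdp_prod_XsubC=> msk Fmask.
have [a Fa0] : exists a, root F a.
  case: (mask _ _) Fmask => [|a s] Fmask.
    move: (eqp_size Fmask); rewrite big_nil size_poly1 => sz1.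
    have sz_F : size F = size f.
      by rewrite size_map_poly_id0 // (monicP f_monic) oner_eq0.
    by move: sz_f; rewrite -sz_F sz1.
  by exists a; rewrite (eqp_root Fmask) root_prod_XsubC mem_head.
exists a; first exact/rootP.
have E1 : (F * H)^`().[a] = F^`().[a] * H.[a].
  by rewrite derivM hornerD !hornerM (rootP Fa0) mul0r addr0.
have E2 : ('X^(p ^ lam) - 'X)^`().[a] = -1 :> k.
  rewrite derivB derivXn derivX hornerD hornerN hornerMn hornerXn hornerC.
  by rewrite -mulr_natl natrX (pcharf0 char_k) expr0n gtn_eqF // mul0r sub0r.
apply/eqP=> F'0; have /eqP := E2.
by rewrite -FH E1 F'0 mul0r eq_sym oppr_eq0 oner_eq0.
Qed.

Lemma root_in_local (p lam m : nat) (f h w : {poly int})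
    (A : comNzRingType) (k : finFieldType) (r : {rmorphism A -> k}) :
    prime p -> (0 < lam)%N -> f \is monic -> (1 < size f)%N ->
    f * h = 'X^(p ^ lam) - 'X + p%:R *: w -> #|k| = (p ^ (lam * m))%N ->
    (forall b, r b != 0 -> exists c, c * b = 1) ->
    (forall b, r b = 0 -> exists n, b ^+ n = 0) ->
    (forall c, exists a, r a = c) ->
  exists a : A, root (map_poly intr f) a.
Proof.
move=> pr lam_gt0 f_monic sz_f fh card_k unit_r nil_r surj_r.
have [c fc0 f'c] := residual_simple_root pr lam_gt0 f_monic sz_f fh card_k.
have [a Da] := surj_r c.
have red_f (u : {poly int}) : r (map_poly intr u).[a] = (map_poly intr u).[c].
  by rewrite -horner_map map_poly_intr /= Da.
apply: (Hensel_nilpotent (a := a) unit_r nil_r); first by rewrite red_f.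
by rewrite deriv_map red_f -deriv_map.
Qed.

(** * Finite local rings *)

Section FiniteLocalRing.
Variables (A : comPzRingType) (s : seq A).
Hypothesis s_full : forall a, a \in s.

(** A proper ideal that is not maximal lies in a strictly larger proper ideal;
    the number of elements bounds the length of such a chain. *)
Lemma finite_maximal_ideal (J : ideal A) : 1 \notin J ->
  exists2 M : ideal A, maximal_ideal M & {subset J <= M}.
Proof.
pose c (I : ideal A) := count (fun a => a \in I) s.
have [n le_n] : exists n, (size s - c J <= n)%N by exists (size s - c J)%N.
elim: n J le_n => [|n IH] J le_n J1.
  case/negP: J1; have : all (fun a => a \in J) s.
    by rewrite all_count eqn_leq count_size /= -subn_eq0 -leqn0.
  by move/allP; apply.
have [maxJ|notmax] := pselect (maximal_ideal J); first by exists J.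
have [I [JI I1 nIJ]] : exists I : ideal A,
    [/\ {subset J <= I}, 1 \notin I & ~ {subset I <= J}].
  apply/not_existsP => h; apply: notmax; split=> // I JI I1.
  by apply: contrapT => nIJ; apply: (h I).
have [b [bI bJ]] : exists b, b \in I /\ b \notin J.
  apply/not_existsP => h; apply: nIJ => b bI; apply/negPn/negP=> bJ.
  by apply: (h b).
have lt_c : (c J < c I)%N.
  pose d a := (a \in I) && (a \notin J).
  have d_gt0 : (0 < count d s)%N.
    by rewrite -has_count; apply/hasP; exists b; rewrite // /d bI.
  rewrite -addn1; apply: leq_trans (leq_add (leqnn _) d_gt0) _.
  rewrite -count_predUI (@eq_count _ (predI _ _) pred0) ?count_pred0 ?addn0.
    by apply: sub_count => a /orP[/JI //|/andP[]].
  by move=> a; rewrite /= /d; case: (a \in J); rewrite ?andbF.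
have [||M maxM IM] := IH I => //; last by exists M => // a /JI/IM.
have := count_size (fun a => a \in I) s; rewrite -/(c I).
by move: le_n lt_c; lia.
Qed.

Variables (m : ideal A).
Hypothesis A_local : local_with_max m.

(** Otherwise the principal ideal of a would lie in a maximal ideal, that is,
    in m. *)
Lemma local_unit (a : A) : a \notin m -> exists b, b * a = 1.
Proof.
move=> am; have [/asboolP[b ->]|J1] := boolP (1 \in principal_ideal a); first by exists b.
have [M maxM aM] := finite_maximal_ideal J1.
case/negP: am; rewrite -(A_local.2 M maxM); apply: aM.
by apply/asboolP; exists 1; rewrite mul1r.
Qed.

(** Two powers of a agree, say a^i = a^(i+d) with d > 0, and 1 - a^d is a unit
    because a^d lies in the maximal ideal. *)
Lemma local_nilpotent (a : A) : a \in m -> exists n, a ^+ n = 0.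
Proof.
move=> am.
have [i [d [d_gt0 Dd]]] : exists i d, (0 < d)%N /\ a ^+ i = a ^+ (i + d).
  have : ~~ uniq [seq a ^+ i | i <- iota 0 (size s).+1].
    apply/negP=> /uniq_leq_size => /(_ s) h.
    have := h (fun b _ => s_full b); rewrite size_map size_iota ltnn => //.
  case/(uniqPn 1) => i [j [lt_ij]]; rewrite size_map size_iota => lt_j.
  rewrite !(nth_map 0%N) ?size_iota ?(ltn_trans lt_ij) // !nth_iota ?(ltn_trans lt_ij) //.
  rewrite !add0n => E; exists i, (j - i)%N; rewrite subn_gt0 lt_ij subnKC //.
  exact: ltnW.
have adm : a ^+ d \in m.
  by case: d d_gt0 {Dd} => // d _; rewrite exprSr; apply: ideal_absorb.
have [b Db] : exists b, b * (1 - a ^+ d) = 1.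
  apply: local_unit; apply/negP=> h; case/negP: A_local.1.1.
  by rewrite -(subrK (a ^+ d) 1) rpredD.
exists i; rewrite -[LHS]mul1r -Db -mulrA mulrBl mul1r -exprD addnC -Dd subrr.
by rewrite mulr0.
Qed.

End FiniteLocalRing.

Lemma residue_char_nilpotent (A : comPzRingType) (s : seq A) (m : ideal A)
    (k : finFieldType) (f : {rmorphism quot_ring m -> k}) (p mu : nat) :
    (forall a, a \in s) -> local_with_max m -> prime p -> #|k| = (p ^ mu)%N ->
    injective f ->
  exists n, (p ^ n)%:R = 0 :> A.
Proof.
move=> s_full A_local pr card_k f_inj.
have [n pn] : exists n, (p%:R : A) ^+ n = 0.
  apply: (local_nilpotent s_full A_local); rewrite -[p%:R]subr0.
  have pi_nat c : \pi_(quot_ring m) c%:R = c%:R.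
    elim: c => [|c IH]; last by rewrite -!natr1 -IH qr_addE.
    by apply: (addIr (\pi_(quot_ring m) 0)); rewrite add0r qr_addE addr0.
  apply/quot_ringP; rewrite (pi_nat p) (pi_nat 0%N); apply: f_inj.
  by rewrite rmorph_nat rmorph0 (pcharf0 (card_finPcharP card_k pr)).
by exists n; rewrite natrX.
Qed.

(** The universal property behind both parts of the proposition: one unramified
    extension of degree lam maps to every finite local ring whose residue degree
    is a multiple of lam. The uniformity in A matters: over a product of local
    rings the same extension must act on every factor. *)
Lemma unramified_ext_exists (p : nat) (pr : prime p)
    (Qbar : algebraic_closure (padic_field pr)) (lam : nat) : (0 < lam)%N ->
  exists K : unramified_ext Qbar lam,
    forall (A : comPzRingType) (s : seq A) (m : ideal A) (k : finFieldType)
      (mu : nat) (f : {rmorphism quot_ring m -> k}),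
    (forall a, a \in s) -> local_with_max m ->
    #|k| = (p ^ (lam * mu))%N -> bijective f ->
    inhabited {rmorphism unramified_integers K -> A}.
Proof.
move=> lam_gt0.
have [g [h [w [g_monic sz_g g_irr gh]]]] := exists_unramified_poly pr lam_gt0.
have [K K_hom] := unramified_ext_of_poly Qbar lam_gt0 g_monic sz_g g_irr.
exists K => A s m k mu f s_full A_local card_k f_bij.
have nz1 : 1 != 0 :> A.
  by apply/eqP=> E; have := A_local.1.1; rewrite E rpred0.
pose nzm := GRing.PzSemiRing_isNonZero.Build A nz1.
pose A' : comNzRingType := HB.pack A nzm.
pose r (a : A') : k := f (\pi_(quot_ring m) a).
have rD : {morph r : a b / a + b}.
  by move=> a b; rewrite /r -rmorphD; congr (f _); rewrite qr_addE.
have rB : zmod_morphism r.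
  by move=> a b; apply/(addIr (r b)); rewrite -rD !subrK.
have rM : monoid_morphism r.
  split; first by rewrite /r -[RHS](rmorph1 f).
  by move=> a b; rewrite /r -rmorphM; congr (f _); rewrite -qr_mulE.
pose c1 := GRing.isZmodMorphism.Build _ _ r rB.
pose c2 := GRing.isMonoidMorphism.Build _ _ r rM.
pose rR : {rmorphism A' -> k} := HB.pack r c1 c2.
have r0 a : (rR a == 0) = (a \in m).
  rewrite -[rR a]/(f _) -(rmorph0 f) (inj_eq (bij_inj f_bij)).
  have -> : (0 : quot_ring m) = \pi_(quot_ring m) 0.
    by apply: (addIr (\pi_(quot_ring m) 0)); rewrite add0r qr_addE addr0.
  apply/eqP/idP => [/quot_ringP|am]; first by rewrite subr0.
  by apply/quot_ringP; rewrite subr0.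
have unit_r a : rR a != 0 -> exists b : A', b * a = 1.
  by rewrite r0; apply: (local_unit s_full A_local).
have nil_r a : rR a = 0 -> exists n, a ^+ n = 0.
  by move/eqP; rewrite r0; apply: (local_nilpotent s_full A_local).
have surj_r c : exists a, rR a = c.
  have [finv fK finvK] := f_bij; exists (repr (finv c)).
  by rewrite -[LHS]/(f (\pi_(quot_ring m) _)) reprK finvK.
have [a ga0] : exists a : A', root (map_poly intr g) a.
  apply: (root_in_local pr lam_gt0 g_monic _ gh card_k unit_r nil_r surj_r).
  by rewrite sz_g ltnS.
have [n pn] := residue_char_nilpotent s_full A_local pr card_k (bij_inj f_bij).
have pn1 : (p ^ n.+1)%:R = 0 :> A' by rewrite expnS natrM [X in _ * X]pn mulr0.
have [iota _] := padic_rmorphism pr pn1.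
have [phi] := K_hom A' iota a ga0.
exact: (inhabits phi).
Qed.

(** * Finite abelian groups *)

(** Finiteness of a type is expressed by an enumeration s of its elements, which
    transfers along injections to quotients, to corners and to subbraces without
    a second structure on these types. *)
Lemma full_seq_inj (T U : eqType) (s : seq U) (g : T -> U) :
  (forall y, y \in s) -> injective g -> exists r : seq T, forall x, x \in r.
Proof.
move=> s_full g_inj.
pose h y := if pselect (exists x, g x = y) is left ex
            then Some (projT1 (cid ex)) else None.
exists (pmap h s) => x; rewrite mem_pmap; apply/mapP; exists (g x) => //.
rewrite /h; case: pselect => [ex|nex]; last by case: nex; exists x.
by congr Some; apply: g_inj; rewrite (projT2 (cid ex)).
Qed.

Lemma full_seq_finite (T : eqType) :
  finite_set [set: T]%classic -> exists s : seq T, forall x, x \in s.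
Proof.
case/finite_seqP=> s sE; exists s => x.
by have : [set: T]%classic x by []; rewrite sE.
Qed.

Section FiniteZmodule.
Variables (V : zmodType) (s : seq V).
Hypothesis s_full : forall x, x \in s.

(** Gives access to finite group theory; F is V itself with the enumeration as
    its finite structure. *)
Lemma finite_finZmod :
  exists (F : finZmodType) (f : {additive F -> V}), bijective f.
Proof.
pose u := undup s.
have u_full x : x \in u by rewrite mem_undup s_full.
have uK : pcancel (index^~ u) (fun i => ohead (drop i u)).
  by move=> x; rewrite (drop_nth x) ?index_mem //= nth_index.
pose cnt := isCountable.Build V uK.
pose fin := isFinite.Build V (Finite.uniq_enumP (undup_uniq s) u_full).
pose F : finZmodType := HB.pack V cnt fin.
pose idB := GRing.isZmodMorphism.Build F V id (fun _ _ => erefl).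
pose f : {additive F -> V} := HB.pack (id : F -> V) idB.
by exists F, f; exists id.
Qed.

Lemma card_finType_II (F : finType) (f : F -> V) : bijective f ->
  ([set: V]%classic #= `I_#|F|)%card.
Proof.
move=> [g fK gK].
have <- : range (fun i : 'I_#|F| => f (enum_val i)) = [set: V]%classic.
  by apply/seteqP; split=> // x _; exists (enum_rank (g x)); rewrite ?enum_rankK ?gK.
apply: card_eq_trans (card_esym card_II).
apply: inj_card_eq => i j _ _ /(can_inj fK); exact: enum_val_inj.
Qed.

Lemma card_prime_power_torsion p n : prime p -> (forall x : V, x *+ (p ^ n) = 0) ->
  exists m, ([set: V]%classic #= `I_(p ^ m))%card.
Proof.
move=> pr pnV; have [F [f f_bij]] := finite_finZmod.
have pF : (p.-group [set: F])%g.
  rewrite -pnat_exponent; apply: (@pnat_dvd _ (p ^ n)); last by rewrite pnatX pnat_id.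
  apply/exponentP => x _; rewrite FinRing.zmodXgE; apply: (bij_inj f_bij).
  by rewrite raddfMn pnV -[RHS]/(f 0) raddf0.
have cF : #|F| = (p ^ logn p #|F|)%N.
  by have := card_pgroup pF; rewrite cardsT.
by exists (logn p #|F|); rewrite -cF; apply: card_finType_II f_bij.
Qed.

Lemma card_annihilates c : ([set: V]%classic #= `I_c)%card -> forall x : V, x *+ c = 0.
Proof.
have [F [f f_bij]] := finite_finZmod => cV x.
have -> : c = #|F|.
  apply/card_eq_II; apply: card_eq_trans (card_esym cV) _.
  exact: card_finType_II f_bij.
have [g fK gK] := f_bij; rewrite -(gK x) -raddfMn -cardsT -FinRing.zmodXgE.
by rewrite expg_cardG ?inE // raddf0.
Qed.
End FiniteZmodule.

(** * Braces *)

Section Braces.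
Variables (V : zmodType) (B : brace V).

(** The inverse of gamma_x is translation by x followed by the circle action of
    the inverse of x. *)
Lemma gamma_bij x : bijective (gamma B x).
Proof.
exists (fun y => circ B (cinv B x) (x + y)) => y; rewrite /gamma.
  by rewrite addrA subrr add0r circA circVn circ1n.
by rewrite circA circnV circ1n addrA addNr add0r.
Qed.

Lemma circ_x0 x : circ B x 0 = x.
Proof.
have := circD B x 0 0; rewrite addr0 -addrA.
by rewrite -{1}[circ B x 0]addr0 => /addrI/esym/eqP; rewrite addrC subr_eq0 => /eqP.
Qed.

Lemma cone0 : cone B = 0.
Proof. by rewrite -(circ_x0 (cone B)) circ1n. Qed.

Lemma circE x y : circ B x y = x + gamma B x y.
Proof. by rewrite /gamma addrA subrr add0r. Qed.

(** Expresses the inverse by a gamma function, so that stability under these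
    functions gives stability under inverses. *)
Lemma cinvE x : cinv B x = - gamma B (cinv B x) x.
Proof. by rewrite /gamma circVn cone0 addr0 opprK. Qed.

Lemma admits_module_brace_rmorphism (R S : pzRingType) (phi : {rmorphism S -> R}) :
  admits_module_brace R B -> admits_module_brace S B.
Proof.
move=> [m mP].
have scA a b x :
    ms_scale m (phi a) (ms_scale m (phi b) x) = ms_scale m (phi (a * b)) x.
  by rewrite ms_scaleA rmorphM.
have sc1 : left_id 1 (fun a => ms_scale m (phi a)).
  by move=> x; rewrite rmorph1 ms_scale1.
have scDr : right_distributive (fun a => ms_scale m (phi a)) +%R.
  by move=> a x y; rewrite ms_scaleDr.
have scDl x : {morph (fun a => ms_scale m (phi a) x) : a b / a + b}.
  by move=> a b; rewrite rmorphD ms_scaleDl.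
exists (ModuleStructure scA sc1 scDr scDl) => x.
by split; [move=> a; apply: (mP x).1|apply: (mP x).2].
Qed.

End Braces.

Section Component.
Variables (R : comPzRingType) (N : lmodType R).
Local Notation A := (quot_ring (Ann N)).

Lemma quot_scaleA (a b : A) (x : N) :
  quot_scale a (quot_scale b x) = quot_scale (a * b) x.
Proof.
have -> : a * b = \pi_A (repr a * repr b) by [].
by rewrite quot_scaleE -scalerA.
Qed.

Lemma quot_scale1 (x : N) : quot_scale 1 x = x.
Proof. by rewrite quot_scaleE scale1r. Qed.

Lemma quot_scaleDr (a : A) (x y : N) :
  quot_scale a (x + y) = quot_scale a x + quot_scale a y.
Proof. exact: scalerDr. Qed.

Lemma quot_scaleDl (a b : A) (x : N) :
  quot_scale (a + b) x = quot_scale a x + quot_scale b x.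
Proof.
by rewrite -[a in LHS]reprK -[b in LHS]reprK qr_addE quot_scaleE -scalerDl.
Qed.

Lemma quot_scale0 (x : N) : quot_scale 0 x = 0.
Proof. by apply: (addIr (quot_scale 0 x)); rewrite -quot_scaleDl !add0r. Qed.

Lemma quot_scale_natr (n : nat) (x : N) : quot_scale (n%:R) x = x *+ n.
Proof.
elim: n => [|n IH]; first by rewrite quot_scale0.
by rewrite -natr1 quot_scaleDl IH quot_scale1 mulrSr.
Qed.

Lemma quot_scale_faithful (a : A) : (forall x : N, quot_scale a x = 0) -> a = 0.
Proof.
move=> a0; rewrite -[a]reprK.
have -> : (0 : A) = \pi_A 0.
  by apply: (addIr (\pi_A 0)); rewrite add0r qr_addE addr0.
apply/quot_ringP; rewrite subr0; apply/asboolP => x; exact: a0.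
Qed.

Variables (B : brace N) (N_brace : module_brace B).

Lemma gamma_quot_scale x (a : A) y :
  gamma B x (quot_scale a y) = quot_scale a (gamma B x y).
Proof.
have lin := (N_brace x).1.
have g0 : gamma B x 0 = 0 by rewrite /gamma circ_x0 addNr.
by have := lin (repr a) y 0; rewrite !addr0 g0 addr0.
Qed.

Lemma gammaD x y z : gamma B x (y + z) = gamma B x y + gamma B x z.
Proof. by have := (N_brace x).1 1 y z; rewrite !scale1r. Qed.

Lemma quot_ring_admits : admits_module_brace A B.
Proof.
have scDr : right_distributive (@quot_scale R N) +%R.
  by move=> a x y; apply: quot_scaleDr.
exists (ModuleStructure quot_scaleA quot_scale1 scDr (fun x a b => quot_scaleDl a b x)).
move=> x; split; last exact: gamma_bij.
by move=> a y z; rewrite gammaD; congr (_ + _); apply: gamma_quot_scale.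
Qed.

Variable e : idem_elt A.

Lemma componentP x : reflect (quot_scale (idem e) x = x) (x \in component (idem e)).
Proof.
apply: (iffP (asboolP _)) => [[y ->]|<-]; last by exists x.
by rewrite quot_scaleA idemP.
Qed.

Lemma component_zmod_closed : zmod_closed (component (N := N) (idem e)).
Proof.
split=> [|x y /componentP xe /componentP ye]; apply/componentP; first exact: scaler0.
rewrite quot_scaleDr xe; congr (_ + _); rewrite -[RHS]opprK -[in RHS]ye.
by rewrite /quot_scale scalerN opprK.
Qed.

Lemma component_gamma x y :
  y \in component (idem e) -> gamma B x y \in component (idem e).
Proof.
by move=> /componentP ye; apply/componentP; rewrite -gamma_quot_scale ye.
Qed.

(** The gamma functions are A-linear, so they preserve eN, and the product
    and inverse of the circle group are expressed through them. *)
Lemma component_subbrace : exists S : subbrace B, S =i component (idem e).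
Proof.
set E := component (N := N) (idem e).
have [E0 EB] := component_zmod_closed.
have EN x : x \in E -> - x \in E by move=> xE; rewrite -sub0r EB.
have ED x y : x \in E -> y \in E -> x + y \in E.
  by move=> xE yE; rewrite -[y]opprK EB // EN.
have E1 : cone B \in E by rewrite cone0.
have Ec : {in E &, forall x y, circ B x y \in E}.
  by move=> x y xE yE; rewrite circE ED // component_gamma.
have Ei : {in E, forall x, cinv B x \in E}.
  by move=> x xE; rewrite cinvE EN // component_gamma.
by exists (Subbrace component_zmod_closed E1 Ec Ei).
Qed.

Lemma corner_admits (S : subbrace B) : S =i component (idem e) ->
  admits_module_brace (corner e) (induced_brace S).
Proof.
move=> SE.
have stab (a : corner e) (x : sb_type S) :
    quot_scale (corner_val a) (sb_val x) \in sb_pred S.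
  rewrite [_ \in _]SE; apply/componentP; rewrite quot_scaleA mulrC.
  by rewrite (eqP (cornerP a)).
pose sc (a : corner e) (x : sb_type S) := SbElt (stab a x).
have scA a b x : sc a (sc b x) = sc (a * b) x.
  by apply: val_inj; rewrite /= quot_scaleA.
have sc1 : left_id 1 sc.
  move=> x; apply: val_inj; rewrite /=; apply/componentP.
  by rewrite -SE; apply: sb_valP.
have scDr : right_distributive sc +%R.
  by move=> a x y; apply: val_inj; rewrite /= quot_scaleDr.
have scDl x : {morph sc^~ x : a b / a + b}.
  by move=> a b; apply: val_inj; rewrite /= quot_scaleDl.
exists (ModuleStructure scA sc1 scDr scDl) => x; split; last exact: gamma_bij.
move=> a y z; apply: val_inj.
rewrite -[LHS]/(gamma B (sb_val x)
                  (quot_scale (corner_val a) (sb_val y) + sb_val z)).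
by rewrite gammaD; congr (_ + _); apply: gamma_quot_scale.
Qed.

End Component.

(** * Decomposition into local factors *)

Local Open Scope classical_set_scope.

Lemma coprime_torsion_eq0 (V : zmodType) (y : V) (a b : nat) :
  coprime a b -> y *+ a = 0 -> y *+ b = 0 -> y = 0.
Proof.
case: (posnP a) => [-> /eqP|a_gt0 /eqP co ya yb].
  by rewrite gcd0n => -> _; rewrite mulr1n.
have [u v uv _] := egcdnP b a_gt0.
have : y *+ (u * a) = y *+ (v * b + 1) by rewrite uv co.
by rewrite mulnC mulrnA ya mul0rn mulrnDr mulnC mulrnA yb mul0rn add0r.
Qed.

(** z |-> (phi_i z)_i, through the decomposition of A into the rings A e_i. *)
Lemma corner_sum_rmorphism (A : comPzRingType) (t : nat) (e : 'I_t -> idem_elt A)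
    (O : pzRingType) (phi : forall i, {rmorphism O -> corner (e i)}) :
    (forall i j, i != j -> idem (e i) * idem (e j) = 0) ->
    \sum_(i < t) idem (e i) = 1 ->
  inhabited {rmorphism O -> A}.
Proof.
move=> e_orth e_sum; pose psi z := \sum_i corner_val (phi i z).
have psiB : zmod_morphism psi.
  by move=> z w; rewrite /psi -sumrB; apply: eq_bigr => i _; rewrite rmorphB.
have psiM : monoid_morphism psi.
  split; first by rewrite -[RHS]e_sum; apply: eq_bigr => i _; rewrite rmorph1.
  move=> z w; rewrite /psi mulr_suml; apply: eq_bigr => i _.
  rewrite mulr_sumr (bigD1 i) //= big1 ?addr0 => [|j ji]; first by rewrite rmorphM.
  rewrite -(eqP (cornerP (phi i z))) -(eqP (cornerP (phi j w))).
  by rewrite mulrACA e_orth 1?eq_sym // mulr0.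
pose c1 := GRing.isZmodMorphism.Build _ _ psi psiB.
pose c2 := GRing.isMonoidMorphism.Build _ _ psi psiM.
pose psiR : {rmorphism O -> A} := HB.pack psi c1 c2.
exact: (inhabits psiR).
Qed.

Lemma faithful_quotient_finite (R : comPzRingType) (N : lmodType R) :
  finite_set [set: N] -> exists s : seq (quot_ring (Ann N)), forall a, a \in s.
Proof.
case/full_seq_finite=> s s_full.
(* a |-> the table of the action of a on N *)
pose g (a : quot_ring (Ann N)) : {ffun 'I_(size s) -> 'I_(size s).+1} :=
  [ffun i : 'I_(size s) => inord (index (quot_scale a s`_i) s)].
apply: (full_seq_inj (s := enum _) (g := g)) => [y|a b ab].
  exact: mem_enum.
apply/eqP; rewrite -subr_eq0; apply/eqP; apply: quot_scale_faithful => x.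
have lt_x : (index x s < size s)%N by rewrite index_mem.
have /(congr1 (@nat_of_ord _)) :=
  congr1 (fun h : {ffun _ -> _} => h (Ordinal lt_x)) ab.
rewrite !ffunE !inordK ?ltnS ?index_size // nth_index // => /(congr1 (nth 0 s)).
rewrite !nth_index // => abx; apply: (addIr (quot_scale b x)).
by rewrite -quot_scaleDl subrK add0r.
Qed.

Theorem proposition4p10
  (Qbar : forall (q : nat) (prq : prime q), algebraic_closure (padic_field prq))
  (R : comPzRingType) (N : lmodType R) (B : brace N)
  (N_finite : finite_set [set: N]) (N_brace : module_brace B)
  (t : nat) (e : 'I_t -> idem_elt (quot_ring (Ann N)))
  (e_orth : forall i j : 'I_t, i != j ->
     idem (e i) * idem (e j) = 0)
  (e_sum : \sum_(i < t) idem (e i) = 1)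
  (m : forall i : 'I_t, ideal (corner (e i)))
  (A_local : forall i : 'I_t, local_with_max (m i))
  (p lam : 'I_t -> nat) (p_prime : forall i : 'I_t, prime (p i))
  (A_residue : forall i : 'I_t,
     exists k : finFieldType, #|k| = (p i ^ lam i)%N /\
       exists f : {rmorphism quot_ring (m i) -> k}, bijective f) :
  (forall i : 'I_t,
     exists S : subbrace B,
       [/\ S =i component (idem (e i)),
           exists n : nat, ([set` S] #= `I_(p i ^ n))%card
         & is_Zp_brace (Qbar (p i) (p_prime i)) (lam i) (induced_brace S)]) /\
  (forall (q : nat) (q_prime : prime q) (n : nat),
     ([set: N] #= `I_(q ^ n))%card ->
     (forall i : 'I_t, p i = q) /\
     ((0 < t)%N ->
        is_Zp_brace (Qbar q q_prime) (\big[gcdn/0%N]_(i < t) lam i) B)).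
Proof.
have [sA sA_full] := faithful_quotient_finite N_finite.
have corner_full i : exists s : seq (corner (e i)), forall a, a \in s.
  exact: full_seq_inj sA_full (val_inj (sT := corner (e i))).
have [sN sN_full] := full_seq_finite N_finite.
have sb_full (S : subbrace B) : exists s : seq (sb_type S), forall x, x \in s.
  exact: full_seq_inj sN_full (val_inj (sT := sb_type S)).
have lam_gt0 i : (0 < lam i)%N.
  have [k [card_k _]] := A_residue i; case: (lam i) card_k => // card_k.
  by have := finNzRing_gt1 k; rewrite card_k.
have char_nil i : exists n, (p i ^ n)%:R = 0 :> corner (e i).
  have [k [card_k [f f_bij]]] := A_residue i; have [s s_full] := corner_full i.
  exact: (residue_char_nilpotent s_full (A_local i) (p_prime i) card_k
           (bij_inj f_bij)).
have sb_nil i : exists n, forall x,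
    x \in component (N := N) (idem (e i)) -> x *+ p i ^ n = 0.
  have [n /(congr1 val) pn0] := char_nil i; exists n => x /componentP xe.
  rewrite -[x]xe -quot_scale_natr quot_scaleA.
  suff -> : (p i ^ n)%:R * idem (e i) = 0 by rewrite quot_scale0.
  have <- : val (1 : corner (e i)) = idem (e i) by [].
  by rewrite mulr_natl -(raddfMn val).
split=> [i|q q_prime n cardN].
  have [S SE] := component_subbrace N_brace (e i); exists S; split=> //.
    have [n pn] := sb_nil i; have [s s_full] := sb_full S.
    have [|c cS] := card_prime_power_torsion s_full (p_prime i) (n := n).
      move=> x; apply: val_inj; rewrite (raddfMn val) raddf0; apply: pn.
      by rewrite -SE; apply: sb_valP.
    exists c; apply: card_eq_trans cS.
    have <- : range (@sb_val N B S) = [set` S].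
      apply/seteqP; split=> [_ [x _ <-]|x Sx]; first exact: sb_valP.
      by exists (SbElt Sx).
    by apply: inj_card_eq => x y _ _; apply: val_inj.
  have [k [card_k [f f_bij]]] := A_residue i; have [s s_full] := corner_full i.
  have [K K_hom] := unramified_ext_exists (Qbar (p i) (p_prime i)) (lam_gt0 i).
  have card_k1 : #|k| = (p i ^ (lam i * 1))%N by rewrite muln1.
  have [phi] := K_hom _ _ _ _ _ f s_full (A_local i) card_k1 f_bij.
  by exists K; apply: admits_module_brace_rmorphism phi (corner_admits N_brace SE).
have p_q i : p i = q.
  have qN := card_annihilates sN_full cardN.
  apply/eqP; apply: contrapT => npq.
  have [c pc] := sb_nil i.
  (* e_i N is killed by a power of p_i and by q^n, so it is 0 *)
  have e0 : idem (e i) = 0.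
    apply: quot_scale_faithful => x; set y := quot_scale _ x.
    have ye : y \in component (idem (e i)) by apply/asboolP; exists x.
    have co : coprime (p i ^ c) (q ^ n).
      apply/coprimeXl/coprimeXr; rewrite prime_coprime // dvdn_prime2 //.
      exact/negP.
    exact: coprime_torsion_eq0 co (pc y ye) (qN y).
  have := (A_local i).1.1; rewrite (_ : 1 = 0) ?rpred0 //.
  by apply: val_inj; rewrite /= e0.
split=> // t_gt0; set l := \big[_/_]_(_ < t) _.
have l_dvd i : (l %| lam i)%N by apply: biggcdn_inf (dvdnn _).
have l_gt0 : (0 < l)%N by apply: dvdn_gt0 (l_dvd (Ordinal t_gt0)).
have [K K_hom] := unramified_ext_exists (Qbar q q_prime) l_gt0.
have phi i : {rmorphism unramified_integers K -> corner (e i)}.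
  apply: inhabited_witness.
  have [k [card_k [f f_bij]]] := A_residue i; have [s s_full] := corner_full i.
  have card_k1 : #|k| = (q ^ (l * (lam i %/ l)))%N.
    by rewrite mulnC divnK // card_k p_q.
  exact: (K_hom _ _ _ _ _ f s_full (A_local i) card_k1 f_bij).
have [psi] := corner_sum_rmorphism phi e_orth e_sum.
by exists K; apply: admits_module_brace_rmorphism psi (quot_ring_admits N_brace).
Qed.
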